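(* Under Assumption (D), the following holds on the event $\mathcal E$ of Assumption (C): (i) $\ell_n(\theta)=\tilde\ell_n(\theta)$ for all $\theta\in\tilde{\mathcal B}=\{\theta\in\mathbb R^p:\|\theta-\theta_{*,p}\|\le3\eta/8\}$; (ii) $\tilde\ell_n$ is $\tilde m$-strongly concave and has $\tilde\Lambda$-Lipschitz gradients on $\mathbb R^p$, with $\tilde\Lambda=7K$ and $\tilde m=c_{\min}np^{-\kappa_3}$. In particular, $\log\tilde\pi(\cdot\mid Z^{(n)})$ is $m$-strongly concave and has $\Lambda$-Lipschitz gradients with $\Lambda=7K+\Lambda_\pi$ and $m=c_{\min}np^{-\kappa_3}+m_\pi$.
   Context: General setting. Let $\Theta\subset\ell^2(\mathbb N)$ contain $\mathbb R^p$ (viewed as sequences vanishing after coordinate $p$); $\|\cdot\|$ is the $\ell^2$/Euclidean norm, $\|\cdot\|_{op}$ the operator norm, $\lambda_{\min}$ the smallest eigenvalue. For $\theta\in\Theta$, $\mathbb P_\theta$ is a law on a measurable space $\mathcal Z$ with density $p_\theta$ w.r.t. a measure $\nu$; data $Z^{(n)}=(Z_i)_{i=1}^n$ have law $\mathbb P^n_\theta=\otimes_{i=1}^n\mathbb P_\theta$. Let $\ell(\theta,z)=\log p_\theta(z)$, $\ell_n(\theta)=\sum_i\ell(\theta,Z_i)$. The prior $\Pi=\Pi_n$ is supported on $\mathbb R^p$ with Lebesgue density $\pi$; the posterior $\Pi(\cdot\mid Z^{(n)})$ has density proportional to $e^{\ell_n(\theta)}\pi(\theta)$. A function $f$ is $m$-strongly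 concave if $f(\theta')\le f(\theta)+(\theta'-\theta)^\top\nabla f(\theta)-\frac m2\|\theta-\theta'\|^2$ for all $\theta,\theta'$, and has $\Lambda$-Lipschitz gradients if $\|\nabla f(\theta)-\nabla f(\theta')\|\le\Lambda\|\theta-\theta'\|$. Assumption (A): the data have law $\mathbb P^n_{\theta_0}$ for a fixed $\theta_0\in\Theta$; there are $c_0>0$, $\theta_{*,p}\in\mathbb R^p$ with $\|\theta_{*,p}\|\le c_0$, and $0<\delta_n\to0$ such that for some $\beta\ge1$, any $c>0$ and any sufficiently large $L$ there are $C_1,\dots,C_4>0$ with $\mathbb P^n_{\theta_0}(\Pi(\{\theta:\|\theta-\theta_{*,p}\|^\beta>L\delta_n\}\mid Z^{(n)})\ge e^{-cn\delta_n^2})\le C_2e^{-C_1n\delta_n^2}$ and $\mathbb P^n_{\theta_0}(\int_{\|\theta-\theta_{*,p}\|\le\delta_n}e^{\ell_n(\theta)-\ell_n(\theta_0)}\pi(\theta)d\theta\le e^{-C_3n\delta_n^2})\le e^{-C_4n\delta_n^2}$. Assumption (B): $\log\pi$ is $m_\pi$-strongly concave with $\Lambda_\pi$-Lipschitz gradients, its maximiser $\theta_{\pi,\max}$ satisfies $\|\theta_{\pi,\max}\|\le c_0$, and the fourth moments of $\Pi$ are bounded uniformly in $n,p$. Assumption (C): there are $0<\eta\le1$, an event $\mathcal E$ with $\mathbb P^n_{\theta_0}(\mathcal E)\ge1-c'e^{-cn\delta_n^2}$ ($c,c'>0$), and $\mathcal B=\{\theta\in\mathbb R^p:\|\theta-\theta_{*,p}\|\le\eta\}$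 such that $\ell_n\in C^2(\mathcal B)$ a.s., and for some $c_{\max}\ge c_{\min}>0$, $\kappa_1,\kappa_2,\kappa_3\ge0$, on $\mathcal E$: $\|\nabla\ell_n(\theta_{*,p})\|\le c_{\max}n\delta_np^{\kappa_1}$, $\sup_{\theta\in\mathcal B}\|\nabla^2\ell_n(\theta)\|_{op}\le c_{\max}np^{\kappa_2}$, and $\inf_{\theta\in\mathcal B}\lambda_{\min}(-\nabla^2\ell_n(\theta))\ge c_{\min}np^{-\kappa_3}$. Surrogate: fix smooth $v:\mathbb R\to[0,1]$ with $v(t)=1$ for $t\le3/4$, $v(t)=0$ for $t>7/8$, and $\|v\|_{C^2}=\max_{j\le2}\sup|v^{(j)}|$; let $\varphi\ge0$ be smooth, even, supported in $[-1,1]$, $\int\varphi=1$, $\varphi_t(x)=t^{-1}\varphi(x/t)$; $\gamma_\eta(t)=0$ for $t<5\eta/8$, $(t-5\eta/8)^2$ otherwise; $v_\eta=\varphi_{\eta/8}*\gamma_\eta$. For $K>0$, $\theta_{\mathrm{init}}\in\mathbb R^p$: $\tilde\ell_n(\theta)=v(\|\theta-\theta_{\mathrm{init}}\|/\eta)(\ell_n(\theta)-\ell_n(\theta_{\mathrm{init}}))+\ell_n(\theta_{\mathrm{init}})-Kv_\eta(\|\theta-\theta_{\mathrm{init}}\|)$, and $\tilde\pi(\theta\mid Z^{(n)})\propto e^{\tilde\ell_n(\theta)}\pi(\theta)$. Assumption (D): (A), (B), (C) hold, $\|\theta_{\mathrm{init}}-\theta_{*,p}\|\le\eta/8$, and with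 $\tilde\delta_{n,p}=\max(\delta_n^{1/\beta},\delta_np^{\kappa_1+\kappa_3})$, for some $C>0$: $p\le Cn\delta_n^2$, $\eta\ge(\log n)\tilde\delta_{n,p}$, $K\ge60c_{\max}\|v\|_{C^2}n(1+p^{\kappa_2})$.
   Formalization: The formal theorem assumes n ≥ 2; for n = 1, log n = 0 makes the condition η ≥ (log n) δ̃ vacuous, so the gradient bound at θ_* can be arbitrarily large relative to K and the claimed concavity of the surrogate can fail. *)

(* Defs.v *)
From HB Require Import structures.
From mathcomp Require Import all_boot all_order all_algebra.
From mathcomp Require Import all_classical all_reals all_analysis.
Set Implicit Arguments. Unset Strict Implicit. Unset Printing Implicit Defensive.
Import Order.TTheory GRing.Theory Num.Theory.
Import numFieldNormedType.Exports.
Local Open Scope classical_set_scope.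
Local Open Scope ring_scope.

Section Defs.
Variable R : realType.
Variable p : nat.
Notation vec := 'cV[R]_p.

Definition enorm (x : vec) : R := Num.sqrt (\sum_i (x i 0) ^+ 2).
Definition inner (x y : vec) : R := \sum_i x i 0 * y i 0.

Definition evec (i : 'I_p) : vec := delta_mx i 0.

Definition partial (i : 'I_p) (f : vec -> R) : vec -> R :=
  fun x => derive f x (evec i).

Definition grad (f : vec -> R) (x : vec) : vec := \col_i partial i f x.
Definition hess (f : vec -> R) (x : vec) : 'M[R]_p :=
  \matrix_(i, j) partial j (partial i f) x.

Definition opnorm (A : 'M[R]_p) : R :=
  sup [set enorm (A *m x) | x in [set x : vec | enorm x <= 1]].

Definition C2_on (f : vec -> R) (S : set vec) : Prop :=
  forall x, S x ->
    [/\ differentiable f x,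
        (forall i, differentiable (partial i f) x) &
        (forall i j, {for x, continuous (partial j (partial i f))})].

Definition strongly_concave (m : R) (f : vec -> R) : Prop :=
  forall th th' : vec,
    f th' <= f th + inner (th' - th) (grad f th) - m / 2 * (enorm (th - th')) ^+ 2.

Definition lipschitz_grad (L : R) (f : vec -> R) : Prop :=
  forall th th' : vec, enorm (grad f th - grad f th') <= L * enorm (th - th').

Definition loglik (Zt : Type) (n : nat) (dens : vec -> Zt -> R) (Z : 'I_n -> Zt)
  (th : vec) : R := \sum_i ln (dens th (Z i)).

Definition tilde_ell (v veta : R -> R) (eta K : R) (ell : vec -> R) (init : vec)
  (th : vec) : R :=
  v (enorm (th - init) / eta) * (ell th - ell init) + ell init
  - K * veta (enorm (th - init)).
End Defs.

Section Defs1.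
Variable R : realType.

Definition smooth (f : R -> R) : Prop := forall (k : nat) (x : R), derivable (derive1n k f) x 1.

Definition C2norm (v : R -> R) : R :=
  Num.max (sup (range (fun t => `|v t|)))
   (Num.max (sup (range (fun t => `|derive1n 1 v t|)))
            (sup (range (fun t => `|derive1n 2 v t|)))).

Definition mollif (phi : R -> R) (t : R) : R -> R := fun x => t^-1 * phi (x / t).

Definition gamma_eta (eta : R) (t : R) : R :=
  if t < 5 * eta / 8 then 0 else (t - 5 * eta / 8) ^+ 2.

Definition v_eta (phi : R -> R) (eta : R) (t : R) : R :=
  \int[lebesgue_measure]_s (mollif phi (eta / 8) (t - s) * gamma_eta eta s).
End Defs1.

(* Main.v *)
(* In the radial variable [r = |th - th_init|], the surrogate has second derivative
   [D2 (v(r / eta) (l_n - l_n(th_init))) - K D2 (v_eta(r))].  Where [r < 3 eta / 4] the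
   cutoff is [1], [v_eta(r)] is convex, and the eigenvalue bound on [- D2 l_n] gives the
   concavity.  Where [r >= 3 eta / 4], evenness of [phi] makes [v_eta] exactly
   [(t - 5 eta / 8) ^ 2] up to a constant, so that [D2 (v_eta(r)) >= 1 / 3]; the penalty
   then dominates the derivatives of the cutoff term because [K] is large.  Beyond
   [7 eta / 8] the cutoff and its derivatives vanish, so that the behaviour of [l_n]
   outside the ball is irrelevant.  Mean value inequalities along segments turn the bounds
   on second derivatives into the two conclusions. *)
Require Import Defs.
From HB Require Import structures.
From mathcomp Require Import all_boot all_order all_algebra.
From mathcomp Require Import all_classical all_reals all_analysis.
From mathcomp Require Import ring lra.
Set Implicit Arguments. Unset Strict Implicit. Unset Printing Implicit Defensive.
Import Order.TTheory GRing.Theory Num.Theory.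
Import numFieldNormedType.Exports.
Local Open Scope classical_set_scope.
Local Open Scope ring_scope.

(** * Euclidean geometry and the Rayleigh quotient *)

(** Two singularities must be avoided: [ell] is regular only on [B], and the norm is not
    differentiable at its origin. The first is handled by the radii, since the cutoff radius
    [7 eta / 8] plus the offset [eta / 8] of [th_init] is [eta]; the second because cutoff and
    penalty are both constant for [r < eta / 2]. The curvature hypothesis concerns eigenvalues
    rather than a quadratic form, so the Hessian has to be shown symmetric before it can be used.
    Differentiating the cutoff costs a factor [1 / eta], for which no uniform bound is assumed; the
    rate condition makes the gradient of [ell] on [B] at most a multiple of [eta], which cancels
    this factor and leaves a cost of order [n (1 + p ^ k2)], the order of [K]. *)

Section Euclidean.
Variables (R : realType) (p : nat).
Implicit Types (x y z : 'cV[R]_p) (A : 'M[R]_p).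

Lemma innerC x y : inner x y = inner y x.
Proof. by apply: eq_bigr => i _; rewrite mulrC. Qed.

Lemma innerDl x y z : inner (x + y) z = inner x z + inner y z.
Proof. by rewrite -big_split; apply: eq_bigr => i _; rewrite mxE mulrDl. Qed.

Lemma innerDr x y z : inner z (x + y) = inner z x + inner z y.
Proof. by rewrite !(innerC z) innerDl. Qed.

Lemma innerZl a x y : inner (a *: x) y = a * inner x y.
Proof. by rewrite mulr_sumr; apply: eq_bigr => i _; rewrite mxE mulrA. Qed.

Lemma innerZr a x y : inner y (a *: x) = a * inner y x.
Proof. by rewrite !(innerC y) innerZl. Qed.

Lemma innerNl x y : inner (- x) y = - inner x y.
Proof. by rewrite -scaleN1r innerZl mulN1r. Qed.

Lemma innerNr x y : inner y (- x) = - inner y x.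
Proof. by rewrite !(innerC y) innerNl. Qed.

Lemma innerBl x y z : inner (x - y) z = inner x z - inner y z.
Proof. by rewrite innerDl innerNl. Qed.

Lemma innerBr x y z : inner z (x - y) = inner z x - inner z y.
Proof. by rewrite innerDr innerNr. Qed.

Lemma inner_evec i x : inner (evec R i) x = x i 0.
Proof.
rewrite /inner (bigD1 i)//= big1 ?addr0 ?mxE ?eqxx ?mul1r// => j ji.
by rewrite mxE (negbTE ji) mul0r.
Qed.

Lemma enorm_ge0 x : 0 <= enorm x.
Proof. exact: sqrtr_ge0. Qed.

Lemma sqr_enorm x : enorm x ^+ 2 = inner x x.
Proof.
rewrite sqr_sqrtr; last by apply: sumr_ge0 => i _; exact: sqr_ge0.
by apply: eq_bigr => i _; rewrite expr2.
Qed.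

Lemma inner_ge0 x : 0 <= inner x x.
Proof. by rewrite -sqr_enorm sqr_ge0. Qed.

Lemma enorm_eq0 x : enorm x = 0 -> x = 0.
Proof.
move=> x0; have := sqr_enorm x; rewrite x0 expr0n/= => /esym /eqP.
rewrite psumr_eq0; last by move=> i _; rewrite -expr2 sqr_ge0.
move=> /allP xi; apply/matrixP => i j; rewrite ord1 mxE.
by have := xi i; rewrite mem_index_enum -expr2 sqrf_eq0/= => /(_ isT) /eqP.
Qed.

Lemma enormZ a x : enorm (a *: x) = `|a| * enorm x.
Proof.
apply/eqP; rewrite -(@eqrXn2 _ 2)// ?mulr_ge0 ?enorm_ge0//.
by rewrite exprMn !sqr_enorm innerZl innerZr real_normK ?num_real// mulrA.
Qed.

Lemma enormN x : enorm (- x) = enorm x.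
Proof. by rewrite -scaleN1r enormZ normrN1 mul1r. Qed.

Lemma enormB x y : enorm (x - y) = enorm (y - x).
Proof. by rewrite -opprB enormN. Qed.

Lemma enorm0 : enorm (0 : 'cV[R]_p) = 0.
Proof. by rewrite -(scale0r 0) enormZ normr0 mul0r. Qed.

Lemma inner0l x : inner 0 x = 0.
Proof. by rewrite -(scale0r 0) innerZl mul0r. Qed.

Lemma CauchySchwarz_inner x y : inner x y <= enorm x * enorm y.
Proof.
have [->|x0] := eqVneq x 0; first by rewrite inner0l mulr_ge0 ?enorm_ge0.
have [->|y0] := eqVneq y 0.
  by rewrite innerC inner0l mulr_ge0 ?enorm_ge0.
have nx : 0 < enorm x.
  by rewrite lt_neqAle enorm_ge0 andbT eq_sym; apply: contra_neq x0; exact: enorm_eq0.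
have ny : 0 < enorm y.
  by rewrite lt_neqAle enorm_ge0 andbT eq_sym; apply: contra_neq y0; exact: enorm_eq0.
have := inner_ge0 (enorm y *: x - enorm x *: y).
rewrite innerBl !innerBr !innerZl !innerZr -!sqr_enorm (innerC y x).
move: (inner x y) (enorm x) (enorm y) nx ny => c a b a0 b0.
have -> : b * (b * a ^+ 2) - b * (a * c) - (a * (b * c) - a * (a * b ^+ 2))
  = 2 * (a * b) * (a * b - c) by ring.
by rewrite pmulr_rge0 ?mulr_gt0// subr_ge0.
Qed.

Lemma CauchySchwarz_norm x y : `|inner x y| <= enorm x * enorm y.
Proof.
rewrite ler_norml CauchySchwarz_inner andbT lerNl -innerNl -(enormN x).
exact: CauchySchwarz_inner.
Qed.

Lemma ler_enormD x y : enorm (x + y) <= enorm x + enorm y.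
Proof.
rewrite -(@ler_pXn2r _ 2)// ?nnegrE ?addr_ge0 ?enorm_ge0//.
rewrite sqr_enorm sqrrD innerDl !innerDr -!sqr_enorm (innerC y x) -addrA.
rewrite -[leRHS]addrA lerD2l addrA lerD2r.
by have := CauchySchwarz_inner x y; lra.
Qed.

(** Testing with [w = x] suffices. This reduces vector-valued bounds to the scalar mean value
    theorem, one direction [w] at a time. *)
Lemma enorm_le_inner x b : 0 <= b ->
  (forall w, inner x w <= b * enorm w) -> enorm x <= b.
Proof.
move=> b0 /(_ x); rewrite -sqr_enorm expr2.
have [->|x0] := eqVneq (enorm x) 0; first by [].
by rewrite ler_pM2r// lt_neqAle eq_sym x0 enorm_ge0.
Qed.

Lemma ler_opnorm A x : enorm (A *m x) <= opnorm A * enorm x.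
Proof.
(* [sup] is an upper bound only of a bounded set; Cauchy-Schwarz on each row supplies the
   boundedness. *)
have bnd y : enorm y <= 1 ->
    enorm (A *m y) <= Num.sqrt (\sum_i enorm (row i A)^T ^+ 2).
  move=> y1; apply: ler_wsqrtr; apply: ler_sum => i _.
  have -> : (A *m y) i 0 = inner (row i A)^T y.
    by rewrite !mxE; apply: eq_bigr => j _; rewrite !mxE.
  rewrite -[leLHS]real_normK ?num_real// ler_pXn2r ?nnegrE ?enorm_ge0//.
  by rewrite (le_trans (CauchySchwarz_norm _ _))// ler_piMr ?enorm_ge0.
have ub y : enorm y <= 1 -> enorm (A *m y) <= opnorm A.
  move=> y1; apply: ub_le_sup; last by exists y.
  by exists (Num.sqrt (\sum_i enorm (row i A)^T ^+ 2)) => _ [z /= z1 <-]; exact: bnd.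
have [->|x0] := eqVneq x 0; first by rewrite mulmx0 !enorm0 mulr0.
have nx : 0 < enorm x.
  by rewrite lt_neqAle enorm_ge0 andbT eq_sym; apply: contra_neq x0; exact: enorm_eq0.
have := ub ((enorm x)^-1 *: x).
rewrite -scalemxAr !enormZ gtr0_norm ?invr_gt0// mulVf ?gt_eqF// => /(_ (lexx _)).
by rewrite mulrC ler_pdivrMr.
Qed.

Lemma linear_coef_eq0 (a b : R) : (forall t, 0 <= 2 * t * a + t ^+ 2 * b) -> a = 0.
Proof.
move=> H; have b0 : 0 <= b by have := H 1; have := H (-1); rewrite expr1n sqrrN expr1n; lra.
(* The quadratic is minimal at [- a / b]; adding [1] covers [b = 0] and still gives a negative value
   unless [a = 0]. *)
have := H (- a / (b + 1)).
have -> : 2 * (- a / (b + 1)) * a + (- a / (b + 1)) ^+ 2 * b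
   = - (a ^+ 2 * (b + 2)) / (b + 1) ^+ 2 by field; rewrite gt_eqF; lra.
rewrite mulNr oppr_ge0 pmulr_lle0 ?invr_gt0 ?exprn_gt0; [|lra..].
rewrite pmulr_lle0; last lra.
by rewrite real_exprn_even_le0 ?num_real//= => /eqP.
Qed.

(* A minimiser of the quadratic form on the unit sphere is an eigenvector for
   the minimum. *)
Lemma eigenvalue_lower_bound_inner A (m : R) : A^T = A ->
  (forall a, eigenvalue A a -> m <= a) ->
  forall x, m * enorm x ^+ 2 <= inner x (A *m x).
Proof.
move=> symA lbA x.
have AC y z : inner y (A *m z) = inner (A *m y) z.
  have E (u w : 'cV[R]_p) : inner u w = (u^T *m w) 0 0.
    by rewrite mxE; apply: eq_bigr => i _; rewrite mxE.
  by rewrite !E trmx_mul symA mulmxA.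
have [->|x0] := eqVneq x 0; first by rewrite inner0l enorm0 expr0n mulr0.
have npos y : y != 0 -> 0 < enorm y.
  by move=> y0; rewrite lt_neqAle enorm_ge0 andbT eq_sym; apply: contra_neq y0; exact: enorm_eq0.
(* Row vectors match [EVT_min_rV] and the left eigenvectors of [eigenvalue]; symmetry of [A] passes
   between rows and columns. *)
pose S := [set u : 'rV[R]_p | inner u^T u^T = 1].
pose f (u : 'rV[R]_p) := inner u^T (A *m u^T).
have unitS y : y != 0 -> S ((enorm y)^-1 *: y)^T.
  move=> y0; have ny := npos y y0.
  by rewrite /S/= trmxK -sqr_enorm enormZ gtr0_norm ?invr_gt0// mulVf ?expr1n ?gt_eqF.
have csum (T : topologicalType) (F : 'I_p -> T -> R) :
    (forall i, continuous (F i)) -> continuous (fun t => \sum_i F i t).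
  by move=> cF; apply: continuous_big => //; exact: add_continuous.
have cinner (g h : 'rV[R]_p -> 'cV[R]_p) :
    (forall i, continuous (fun u => g u i 0 : R)) ->
    (forall i, continuous (fun u => h u i 0 : R)) ->
    continuous (fun u => inner (g u) (h u)).
  by move=> cg ch; apply: csum => i u; apply: continuousM; [exact: cg|exact: ch].
have ctr i : continuous (fun u : 'rV[R]_p => u^T i 0 : R).
  move=> u; rewrite /continuous_at.
  under eq_fun do rewrite mxE.
  by rewrite mxE; exact: coord_continuous.
have cf : continuous f.
  apply: cinner => // i.
  under eq_fun do rewrite mxE.
  by apply: csum => j u; apply: continuousM; [exact: cst_continuous|exact: ctr].
have cS : compact S.
  apply: bounded_closed_compact.
    exists 1; split; first exact: num_real.
    move=> M M1 u /= Su; rewrite [leLHS]/Num.norm/= mx_normrE.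
    apply: bigmax_le; first by rewrite (le_trans ler01)// ltW.
    move=> [i j] _ /=; rewrite (ord1 i) (le_trans _ (ltW M1))//.
    rewrite -(@expr_le1 _ 2)// real_normK ?num_real//.
    rewrite -Su /inner (bigD1 j)//= !mxE -expr2 lerDl sumr_ge0// => k _.
    by rewrite -expr2 sqr_ge0.
  have -> : S = (fun u : 'rV[R]_p => inner u^T u^T) @^-1` [set 1] by [].
  apply: closed_comp; last exact: closed_eq.
  by move=> u _; exact: cinner.
have [u /[!inE] Su umin] : exists2 u, u \in S & forall w, w \in S -> f u <= f w.
  apply: EVT_min_rV => //; last exact: continuous_subspaceT.
  by exists ((enorm x)^-1 *: x)^T; exact: unitS.
pose lam := f u.
have lamP y : lam * inner y y <= inner y (A *m y).
  have [->|y0] := eqVneq y 0; first by rewrite !inner0l mulr0.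
  have := umin ((enorm y)^-1 *: y)^T; rewrite inE => /(_ (unitS _ y0)).
  rewrite -/lam /f trmxK -scalemxAr innerZl innerZr.
  rewrite mulrA -expr2 exprVn mulrC ler_pdivlMr ?exprn_gt0 ?npos//.
  by rewrite sqr_enorm.
have eigu : A *m u^T = lam *: u^T.
  apply/eqP; rewrite -subr_eq0; apply/eqP/matrixP => i j; rewrite (ord1 j) [RHS]mxE.
  rewrite -inner_evec; set e := evec R i.
  (* First-order condition at the minimiser: the form of [A - lam] is nonnegative and vanishes at
     [u], so along each coordinate direction its linear term is zero. *)
  apply: (@linear_coef_eq0 _ (inner e (A *m e) - lam * inner e e)) => t.
  have := lamP (u^T + t *: e).
  rewrite mulmxDr -scalemxAr !innerDl !innerDr !innerZl !innerZr.
  rewrite (AC u^T e) !(innerC (A *m u^T)) (innerC u^T e) Su -[inner u^T (A *m u^T)]/lam.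
  rewrite innerNr innerZr.
  by nra.
have : m <= lam.
  apply: lbA; apply/eigenvalueP; exists u.
    by apply: trmx_inj; rewrite trmx_mul symA eigu linearZ.
  apply/eqP => u0; move: Su; rewrite /S/= u0 trmx0 inner0l => /eqP.
  by rewrite eq_sym oner_eq0.
have := lamP x; rewrite sqr_enorm; have := inner_ge0 x.
by nra.
Qed.

End Euclidean.

(** * Derivatives along lines and second-order criteria *)

Section LineDerivative.
Variables (R : realType) (V : normedModType R).
Implicit Types (f g : V -> R) (x d a b : V).

Lemma is_derive_line f x d (t l : R) :
  is_derive (x + t *: d) d f l -> is_derive t 1 (fun s => f (x + s *: d)) l.
Proof.
have E : (fun h => h^-1 *: (((fun s => f (x + s *: d)) \o shift t) (h *: 1)
              - f (x + t *: d))) =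
         (fun h => h^-1 *: ((f \o shift (x + t *: d)) (h *: d) - f (x + t *: d))).
  apply/funext => h /=; congr (_ *: (f _ - _)).
  by rewrite [h *: 1]mulr1 scalerDl addrCA.
move=> [df <-]; apply: DeriveDef; first by rewrite /derivable E.
by rewrite /derive E.
Qed.

Lemma is_derive_translate f x b d (l : R) :
  is_derive (x + b) d f l -> is_derive x d (fun y => f (y + b)) l.
Proof.
have E : (fun h => h^-1 *: (((fun y => f (y + b)) \o shift x) (h *: d)
              - f (x + b))) =
         (fun h : R => h^-1 *: ((f \o shift (x + b)) (h *: d) - f (x + b))).
  by apply/funext => h /=; rewrite addrA.
move=> [df <-]; apply: DeriveDef; first by rewrite /derivable E.
by rewrite /derive E.
Qed.

(** The derivative is required only on the segment, so that the lemma applies to [ell] inside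
    [B]. *)
Lemma MVT_line f g x d (T : R) : 0 <= T ->
  (forall t, 0 <= t <= T -> is_derive (x + t *: d) d f (g (x + t *: d))) ->
  exists2 c, 0 <= c <= T & f (x + T *: d) - f x = T * g (x + c *: d).
Proof.
move=> T0 df.
have dl t : 0 <= t <= T ->
    is_derive t 1 (fun s => f (x + s *: d)) (g (x + t *: d)).
  by move=> tT; apply: is_derive_line; exact: df.
have [||c cT] := @MVT_segment R (fun s => f (x + s *: d))
    (fun s => g (x + s *: d)) 0 T T0.
- by move=> t /[!in_itv]/= /andP[t0 tT]; apply: dl; rewrite !ltW.
- apply: derivable_within_continuous => t /[!in_itv]/= tT.
  by have [] := dl t tT.
rewrite scale0r addr0 subr0 mulrC => ->.
by exists c => //; move: cT; rewrite in_itv.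
Qed.

(** The mean value theorem in direction [a], applied to [f (y + t *: b) - f y], leaves a difference
    of two values of ['D_a f]. Expanding both at [x], the contributions along [a] cancel and
    [t *: 'D_b ('D_a f) x] remains; second derivatives need not be continuous. *)
Lemma second_difference f x a b (e : R) : 0 < e ->
  (\forall y \near x, derivable f y a) ->
  differentiable ('D_a f) x ->
  \forall t \near (0 : R)^'+,
    `|f (x + t *: b + t *: a) - f (x + t *: b) - f (x + t *: a) + f x
      - t ^+ 2 * 'D_b ('D_a f) x| <= e * t ^+ 2.
Proof.
move=> e0 fa da.
(* The two expansion errors are at most [e' * t * (|b| + |a|)] and [e' * t * |a|]; the [+ 1] keeps
   the denominator positive. *)
pose e' := e / (`|b| + 2 * `|a| + 1).
have n0 : 0 < `|b| + 2 * `|a| + 1.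
  by rewrite ltr_wpDl// addr_ge0// mulr_ge0.
have e'0 : 0 < e' by rewrite divr_gt0.
have /eqaddoP /(_ e' e'0) dL := diff_locally da.
have [r1 /= r10 H1] := (@nbhs_ballP _ _ _ _).1 fa.
have [r2 /= r20 H2] := (@nbhs_ballP _ _ _ _).1 dL.
pose r := Num.min r1 r2.
have r0 : 0 < r by rewrite lt_min r10 r20.
near=> t.
have t0 : 0 < t by [].
have tr : t * (`|b| + `|a| + 1) < r.
  rewrite -ltr_pdivlMr; last by rewrite ltr_wpDl// addr_ge0.
  by near: t; apply: nbhs_right_lt; rewrite divr_gt0// ltr_wpDl// addr_ge0.
have small (u c : R) : 0 <= u <= t -> 0 <= c <= t -> `|u *: b + c *: a| < r.
  move=> /andP[u0 ut] /andP[c0 ct]; apply: le_lt_trans tr.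
  rewrite (le_trans (ler_normD _ _))// !normrZ !ger0_norm// !mulrDr mulr1.
  by rewrite -[leLHS]addr0; apply: lerD; [apply: lerD; exact: ler_wpM2r|exact: ltW].
have fd (u c : R) : 0 <= u <= t -> 0 <= c <= t ->
    derivable f (x + u *: b + c *: a) a.
  move=> ut ct; apply: H1; rewrite -ball_normE /= -addrA opprD addNKr normrN.
  by have := small _ _ ut ct; rewrite lt_min => /andP[].
have gL (u c : R) : 0 <= u <= t -> 0 <= c <= t ->
    `|'D_a f (x + u *: b + c *: a) - 'D_a f x - 'd ('D_a f) x (u *: b + c *: a)|
      <= e' * `|u *: b + c *: a|.
  move=> ut ct; have := H2 (u *: b + c *: a).
  rewrite -ball_normE /= sub0r normrN !fctE/= opprD addrA.
  have -> : u *: b + c *: a + x = x + u *: b + c *: a by rewrite addrC addrA.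
  apply.
  by have := small _ _ ut ct; rewrite lt_min => /andP[].
have tt : 0 <= t <= t by rewrite lexx ltW.
have zt : 0 <= (0 : R) <= t by rewrite lexx ltW.
have [||c ct] := @MVT_line (fun y => f (y + t *: b) - f y)
    (fun y => 'D_a f (y + t *: b) - 'D_a f y) x a t.
- exact: ltW.
- move=> c ct; apply: is_deriveB.
    apply: is_derive_translate; apply: derivableP.
    by rewrite addrAC; exact: fd.
  by have := fd _ _ zt ct; rewrite scale0r addr0 => /derivableP.
have -> : x + t *: a + t *: b = x + t *: b + t *: a by rewrite addrAC.
have -> : forall p q s u : R, p - q - s + u = p - s - (q - u) by move=> *; ring.
move=> /= ->.
have -> : x + c *: a + t *: b = x + t *: b + c *: a by rewrite addrAC.
have A1 := gL _ _ tt ct; have A2 := gL _ _ zt ct.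
move: A1 A2; rewrite !scale0r !addr0 !add0r linearD/= linearZ/= -deriveE//.
set G1 := 'D_a f (_ + _); set G2 := 'D_a f (_ + _ *: a).
set G0 := 'D_a f x; set Dc := 'd _ _ _; set Db := 'D_b _ _ => A1 A2.
have ca : `|c *: a| <= t * `|a|.
  by rewrite normrZ; case/andP: ct => c0 ct; rewrite ger0_norm// ler_wpM2r.
have tb : `|t *: b + c *: a| <= t * `|b| + t * `|a|.
  by rewrite (le_trans (ler_normD _ _))// lerD// normrZ gtr0_norm.
have -> : t * (G1 - G2) - t ^+ 2 * Db =
    t * ((G1 - G0 - (t *: Db + Dc)) - (G2 - G0 - Dc)).
  by rewrite [t *: Db]/GRing.scale/=; ring.
rewrite normrM gtr0_norm// expr2 mulrCA ler_pM2l//.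
rewrite (le_trans (ler_normB _ _))//.
apply: (@le_trans _ _ (e' * (t * `|b| + t * `|a|) + e' * (t * `|a|))).
  by apply: lerD; [apply: le_trans A1 _|apply: le_trans A2 _]; rewrite ler_pM2l.
have -> : e' * (t * `|b| + t * `|a|) + e' * (t * `|a|)
   = t * (e' * (`|b| + 2 * `|a|)) by ring.
rewrite mulrC ler_pM2r// /e' mulrAC ler_pdivrMr// ler_pM2l//.
by rewrite lerDl.
Unshelve. all: by end_near. Qed.

(* Both mixed derivatives are limits of the same symmetric second difference
   quotient. *)
Lemma derive_comm f x a b :
  (\forall y \near x, differentiable f y) ->
  differentiable ('D_a f) x -> differentiable ('D_b f) x ->
  'D_b ('D_a f) x = 'D_a ('D_b f) x.
Proof.
move=> df da db; apply/eqP; rewrite -subr_eq0 -normr_le0; apply/ler_addgt0Pl => e e0.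
have e2 : 0 < e / 2 by rewrite divr_gt0.
have fd (u : V) : \forall y \near x, derivable f y u.
  by apply: filterS df => y dfy; exact: diff_derivable.
have Ha := second_difference b e2 (fd a) da.
have Hb := second_difference a e2 (fd b) db.
have [t [t0 [At Bt]]] : exists t, 0 < t /\ (
   `|f (x + t *: b + t *: a) - f (x + t *: b) - f (x + t *: a) + f x
      - t ^+ 2 * 'D_b ('D_a f) x| <= e / 2 * t ^+ 2 /\
   `|f (x + t *: a + t *: b) - f (x + t *: a) - f (x + t *: b) + f x
      - t ^+ 2 * 'D_a ('D_b f) x| <= e / 2 * t ^+ 2).
  have : (\forall t \near (0 : R)^'+, 0 < t) by exact: nbhs_right_gt.
  move=> /(filterI Ha) /(filterI Hb) /filter_ex[t /= [Bt [At t0]]].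
  by exists t; split; [exact: t0|split; [exact: At|exact: Bt]].
rewrite addr0 -(@ler_pM2l _ (t ^+ 2)) ?exprn_gt0//.
move: At Bt; rewrite (addrAC x (t *: b)).
move: (f _) (f x) (f _) (f _) ('D_b _ _) ('D_a _ _) => p q r s h k At Bt.
rewrite -[X in X * `|_|]gtr0_norm ?exprn_gt0// -normrM.
have -> : t ^+ 2 * (h - k)
  = (s - p - r + q - t ^+ 2 * k) - (s - r - p + q - t ^+ 2 * h) by ring.
rewrite (le_trans (ler_normB _ _))//. apply: le_trans (lerD Bt At) _.
by rewrite -mulrDl -splitr mulrC.
Qed.

End LineDerivative.

Section Criterion.
Variables (R : realType) (p : nat).
Implicit Types (f : 'cV[R]_p -> R) (x d w : 'cV[R]_p).

Lemma sum_evec w : w = \sum_i w i 0 *: evec R i.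
Proof.
apply/matrixP => i j; rewrite (ord1 j) summxE (bigD1 i)//= big1 ?addr0.
  by rewrite !mxE !eqxx mulr1.
by move=> k ki; rewrite !mxE eq_sym (negbTE ki) mulr0.
Qed.

Lemma derive_partial f x w : differentiable f x ->
  'D_w f x = \sum_i w i 0 * partial i f x.
Proof.
move=> df; rewrite deriveE// {1}(sum_evec w) linear_sum.
by apply: eq_bigr => i _; rewrite linearZ/= /partial deriveE.
Qed.

Lemma inner_grad f x w : differentiable f x -> inner w (grad f x) = 'D_w f x.
Proof.
by move=> df; rewrite derive_partial//; apply: eq_bigr => i _; rewrite mxE.
Qed.

Lemma hess_sym f x : (\forall y \near x, differentiable f y) ->
  (forall i, differentiable (partial i f) x) -> (hess f x)^T = hess f x.
Proof.
move=> df dpf; apply/matrixP => i j; rewrite !mxE.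
exact: (derive_comm df (dpf j) (dpf i)).
Qed.

Lemma is_derive_inner_grad f x d w : (forall i, differentiable (partial i f) x) ->
  is_derive x d (fun y => inner w (grad f y)) (inner w (hess f x *m d)).
Proof.
move=> dpf.
have -> : (fun y => inner w (grad f y)) = \sum_i (w i 0 *: partial i f).
  apply/funext => y; rewrite fct_sumE; apply: eq_bigr => i _.
  by rewrite mxE.
have -> : inner w (hess f x *m d) = \sum_i w i 0 *: 'D_d (partial i f) x.
  apply: eq_bigr => i _; rewrite mxE derive_partial//; congr (_ * _).
  by apply: eq_bigr => j _; rewrite mxE mulrC.
apply: is_derive_sum => i; apply: is_deriveZ; apply: derivableP.
exact: diff_derivable.
Qed.

(** The derivatives are parameters, so that explicit formulas can be supplied that stay meaningful
    where [ell] is not differentiable. *)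
Variables (f : 'cV[R]_p -> R) (D1 : 'cV[R]_p -> 'cV[R]_p -> R)
  (D2 : 'cV[R]_p -> 'cV[R]_p -> 'cV[R]_p -> R).
Hypothesis df : forall x, differentiable f x.
Hypothesis D1P : forall x w, 'D_w f x = D1 w x.
Hypothesis D2P : forall x d w, is_derive x d (D1 w) (D2 d w x).

Lemma strongly_concave_second_derivative m :
  (forall x d, D2 d d x <= - m * enorm d ^+ 2) -> strongly_concave m f.
Proof.
move=> D2m x y; rewrite inner_grad// D1P enormB; set d := y - x.
have D1' z : is_derive z d f (D1 d z).
  by rewrite -D1P; apply: derivableP; exact: diff_derivable.
(* With the quadratic added, two mean value steps replace a Taylor expansion: in [G c] the term
   [m * enorm d ^+ 2 * c] offsets the bound on [c * D2]. *)
pose F t := f (x + t *: d) + m / 2 * enorm d ^+ 2 * t ^+ 2.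
pose G t := D1 d (x + t *: d) + m * enorm d ^+ 2 * t.
have dF (t : R) : is_derive t 1 F (G t).
  apply: is_deriveD; first exact: is_derive_line.
  apply: (@is_derive_eq _ _ _ ((m / 2 * enorm d ^+ 2) *: (id ^+ 2 : R -> R))).
  by rewrite /GRing.scale/= expr1; field.
have [|c /[!in_itv]/= /andP[c0 c1]] :=
    @MVT_segment R F G 0 1 ler01 (fun t _ => dF t).
  by apply: derivable_within_continuous => t _; have [] := dF t.
have [c' _ D1c] := @MVT_line _ _ (D1 d) (D2 d d) x d c c0 (fun t _ => D2P _ _ _).
rewrite /F /G scale1r scale0r addr0 addrC -/(d) [x + d]addrC subrK subr0 mulr1.
have := D2m (x + c' *: d) d; move: D1c.
move: (D1 d _) (D1 d x) (D2 d d _) => p1 p2 p3 E H.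
rewrite expr1n expr0n/= mulr1 mulr0 addr0 => Ef.
have : c * p3 <= c * (- m * enorm d ^+ 2) by rewrite ler_wpM2l.
by move: Ef E; set n2 := enorm d ^+ 2; lra.
Qed.

Lemma lipschitz_grad_second_derivative L : 0 <= L ->
  (forall x d w, D2 d w x <= L * enorm d * enorm w) -> lipschitz_grad L f.
Proof.
move=> L0 D2L x y; apply: enorm_le_inner; first by rewrite mulr_ge0 ?enorm_ge0.
move=> w; rewrite innerC innerBr !inner_grad// !D1P.
have [c _] := @MVT_line _ _ (D1 w) (D2 (x - y) w) y (x - y) 1 ler01
  (fun t _ => D2P _ _ _).
by rewrite scale1r [y + (x - y)]addrC subrK mul1r => ->; exact: D2L.
Qed.

End Criterion.

(** * Radial functions *)

(** [g] has the same first-order expansion as [f], and uniqueness of the differential identifies it.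
    It serves where the surrogate locally reduces to its penalty. *)
Lemma near_eq_differentiable (R : numFieldType) (V W : normedModType R)
    (f g : V -> W) (x : V) :
  (\near x, f x = g x) -> differentiable f x -> differentiable g x.
Proof.
move=> fg df.
have gE : g \o shift x = cst (g x) + 'd f x +o_ 0 id.
  apply/eqaddoP => e e0.
  have /eqaddoP /(_ e e0) fE := diff_locally df.
  have fg0 : \forall h \near (0 : V), f (h + x) = g (h + x).
    by have := fg; rewrite (near_shift 0 x)/=; apply: filterS => h /=; rewrite subr0.
  near=> h.
  have <- : (f \o shift x - (cst (f x) + 'd f x)) h =
      (g \o shift x - (cst (g x) + 'd f x)) h.
    by rewrite !fctE /= (nbhs_singleton fg) (near fg0 h).
  by near: h.
have cdf : continuous ('d f x) by exact: diff_continuous.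
by apply/diff_locallyP; rewrite (diff_unique cdf gE).
Unshelve. all: by end_near. Qed.

Lemma is_derive_near_cst (R : realType) (f : R -> R) (t l c : R) :
  (\near t, f t = c) -> is_derive t 1 f l -> l = 0.
Proof.
move=> fc [_ <-]; rewrite (@near_eq_derive _ _ _ f (cst c))//.
exact: derive_cst.
Qed.

Section InnerDerivative.
Variables (R : realType) (p : nat) (th0 : 'cV[R]_p).
Implicit Types (th d w : 'cV[R]_p).

Lemma is_derive_coord th d (i : 'I_p) :
  is_derive th d (fun x : 'cV[R]_p => x i 0 : R) (d i 0).
Proof.
have di := @derivable_id R 'cV[R]_p th d.
have dc := (derivable_mxP id th d).1 di i 0.
apply: DeriveDef; first exact: dc.
by have := derive_mx di; rewrite derive_id => /matrixP /(_ i 0); rewrite mxE.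
Qed.

Lemma is_derive_innerl th d w :
  is_derive th d (fun x => inner (x - th0) w) (inner d w).
Proof.
have -> : (fun x => inner (x - th0) w) =
    (\sum_i (w i 0 *: (fun x : 'cV[R]_p => x i 0))) - cst (inner th0 w).
  apply/funext => x; rewrite innerBl !fctE/= fct_sumE; congr (_ - _).
  by apply: eq_bigr => i _; rewrite mulrC.
have -> : inner d w = \sum_i (w i 0 *: (d i 0 : R^o)) - 0.
  by rewrite subr0; apply: eq_bigr => i _; exact: mulrC.
apply: is_deriveB; apply: is_derive_sum => i; apply: is_deriveZ.
exact: is_derive_coord.
Qed.

Lemma differentiable_sqr_dist th :
  differentiable (fun x => \sum_i ((x - th0) i 0) ^+ 2 : R) th.
Proof.
have -> : (fun x => \sum_i ((x - th0) i 0) ^+ 2) =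
   \sum_i ((fun x : 'cV[R]_p => x i 0) - cst (th0 i 0)) ^+ 2.
  apply/funext => x; rewrite fct_sumE; apply: eq_bigr => i _.
  by rewrite exprfctE !mxE.
apply: differentiable_sum => i; apply: differentiableX.
by apply: differentiableB => //; exact: differentiable_coord.
Qed.

Lemma is_derive_sqr_dist th d :
  is_derive th d (fun x => \sum_i ((x - th0) i 0) ^+ 2 : R)
    (2 * inner (th - th0) d).
Proof.
have -> : (fun x => \sum_i ((x - th0) i 0) ^+ 2) =
   \sum_i ((fun x : 'cV[R]_p => x i 0) - cst (th0 i 0)) ^+ 2.
  apply/funext => x; rewrite fct_sumE; apply: eq_bigr => i _.
  by rewrite exprfctE !mxE.
have -> : 2 * inner (th - th0) d =
    \sum_i (2%:R * ((th - th0) i 0) ^+ 1) *: (d i 0 - 0 : R^o).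
  rewrite mulr_sumr; apply: eq_bigr => i _.
  by rewrite subr0 expr1 mulrA.
apply: is_derive_sum => i; rewrite !mxE; apply: is_deriveX.
by apply: is_deriveB; exact: is_derive_coord.
Qed.

End InnerDerivative.

Section Radial.
Variables (R : realType) (p : nat) (th0 : 'cV[R]_p).
Implicit Types (th d w : 'cV[R]_p).

Section FirstOrder.
Variables (psi psi1 : R -> R) (eps c : R).
Hypothesis eps0 : 0 < eps.
Hypothesis dpsi : forall t : R, is_derive t 1 psi (psi1 t).
Hypothesis psic : forall t, t < eps -> psi t = c.

Lemma radial_derivative_eq0 t : t < eps -> psi1 t = 0.
Proof.
move=> te; apply: (@is_derive_near_cst _ psi t _ c) => //.
by near=> s; apply: psic; near: s; exact: lt_nbhsl.
Unshelve. all: by end_near. Qed.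

(** The distance is factored through its square, which is differentiable everywhere. The singularity
    of [Num.sqrt] at [0] is harmless because [psi \o Num.sqrt] is constant for [s < eps ^+ 2]; for
    [s <= 0] the formula gives [0] through [0^-1 = 0]. *)
Let is_derive_comp_sqrt (s : R) :
  is_derive s 1 (psi \o Num.sqrt) (psi1 (Num.sqrt s) / (2 * Num.sqrt s)).
Proof.
have [s0|s0] := ltP 0 s.
  by apply: is_derive1_comp; exact: is_derive1_sqrt.
rewrite ler0_sqrtr// mulr0 invr0 mulr0.
apply: (@near_eq_is_derive _ _ _ (cst c)).
near=> u; rewrite /= psic//.
have [u0|u0] := leP u 0; first by rewrite ler0_sqrtr.
rewrite -(@ltr_pXn2r _ 2)// ?nnegrE ?sqrtr_ge0 ?(ltW eps0)// sqr_sqrtr ?(ltW u0)//.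
by near: u; apply: lt_nbhsl; rewrite (le_lt_trans s0)// exprn_gt0.
Unshelve. all: by end_near. Qed.

Lemma differentiable_radial th :
  differentiable (fun x => psi (enorm (x - th0))) th.
Proof.
have -> : (fun x => psi (enorm (x - th0))) =
  (psi \o Num.sqrt) \o (fun x => \sum_i ((x - th0) i 0) ^+ 2) by [].
apply: differentiable_comp; first exact: differentiable_sqr_dist.
by apply/derivable1_diffP; have [] := is_derive_comp_sqrt (\sum_i ((th - th0) i 0) ^+ 2).
Qed.

Lemma is_derive_radial th w :
  is_derive th w (fun x => psi (enorm (x - th0)))
    (psi1 (enorm (th - th0)) / enorm (th - th0) * inner (th - th0) w).
Proof.
apply: DeriveDef; first exact/diff_derivable/differentiable_radial.
set q := fun x : 'cV[R]_p => \sum_i ((x - th0) i 0) ^+ 2.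
have dq : differentiable q th by exact: differentiable_sqr_dist.
have [dchi chi1] := is_derive_comp_sqrt (q th).
have -> : (fun x => psi (enorm (x - th0))) = (psi \o Num.sqrt) \o q by [].
have dchi' : differentiable (psi \o Num.sqrt) (q th) by exact/derivable1_diffP.
rewrite deriveE; last exact: differentiable_comp.
have [_ dqE] := is_derive_sqr_dist th0 th w.
have lin (u : R) : 'd (psi \o Num.sqrt) (q th) u =
    u * (psi1 (Num.sqrt (q th)) / (2 * Num.sqrt (q th))).
  by rewrite -[u in LHS]mulr1 -[u * 1]/(u *: 1) linearZ/= -deriveE// chi1.
rewrite diff_comp//= lin -deriveE// (dqE : 'D_w q th = _).
rewrite -[enorm (th - th0)]/(Num.sqrt (q th)) invfM /GRing.scale/=.
by move: (Num.sqrt (q th))^-1 => u; field.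
Qed.

End FirstOrder.

Variables (psi psi1 psi2 : R -> R) (eps c : R).
Hypothesis eps0 : 0 < eps.
Hypothesis dpsi : forall t : R, is_derive t 1 psi (psi1 t).
Hypothesis dpsi1 : forall t : R, is_derive t 1 psi1 (psi2 t).
Hypothesis psic : forall t, t < eps -> psi t = c.

(** The quotient [psi1 s / s] is again a profile constant near [0], so the first-order result
    applies to it, and the product rule with a linear form finishes. *)
Lemma is_derive_radial2 th d w :
  let x := th - th0 in let r := enorm x in
  is_derive th d
    (fun y => psi1 (enorm (y - th0)) / enorm (y - th0) * inner (y - th0) w)
    ((psi2 r - psi1 r / r) / r ^+ 2 * inner x d * inner x w
     + psi1 r / r * inner d w).
Proof.
move=> x r.
have p10 t : t < eps -> psi1 t = 0 by exact: (radial_derivative_eq0 dpsi psic).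
have p20 t : t < eps -> psi2 t = 0.
  by move=> te; exact: (radial_derivative_eq0 dpsi1 p10).
have da (t : R) :
    is_derive t 1 (fun s => psi1 s / s) ((psi2 t * t - psi1 t) / t ^+ 2).
  have [te|et] := ltP t eps.
    rewrite p10// p20// mul0r subrr mul0r.
    apply: (@near_eq_is_derive _ _ _ (cst 0)).
    near=> s; rewrite p10 ?mul0r//.
    by near: s; exact: lt_nbhsl.
  have t0 : t != 0 by rewrite gt_eqF// (lt_le_trans eps0).
  have dV : is_derive t 1 (fun s : R => s^-1) (- t ^- 2 *: 1).
    by apply: (@is_deriveV _ id).
  apply: (@is_derive_eq _ _ _ (psi1 * (fun s => s^-1))).
  by rewrite /GRing.scale/= expr2; field.
have ac t : t < eps -> psi1 t / t = 0 by move=> te; rewrite p10// mul0r.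
have H := is_derive_radial eps0 da ac th d.
apply: (@is_derive_eq _ _ _
  ((fun y => psi1 (enorm (y - th0)) / enorm (y - th0)) *
   (fun y => inner (y - th0) w))).
  by apply: is_deriveM; exact: is_derive_innerl.
change (psi1 r / r * inner d w + inner x w *
    ((psi2 r * r - psi1 r) / r ^+ 2 / r * inner x d) =
  (psi2 r - psi1 r / r) / r ^+ 2 * inner x d * inner x w + psi1 r / r * inner d w).
clearbody r.
have [->|r0] := eqVneq r 0; first by rewrite invr0 expr0n/= invr0; ring.
by field.
Unshelve. all: by end_near. Qed.

End Radial.

(** * The mollified quadratic penalty *)

Section Mollification.
Variables (R : realType) (phi : R -> R).
Notation mu := (@lebesgue_measure R).
Hypothesis phi_cont : continuous phi.
Hypothesis phi_ge0 : forall x, 0 <= phi x.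
Hypothesis phi_even : forall x, phi (- x) = phi x.
Hypothesis phi_supp : forall x, 1 < `|x| -> phi x = 0.
Hypothesis phi_int : (\int[lebesgue_measure]_x (phi x)%:E = 1)%E.

(* With [z = (t - 5 eta / 8) / (eta / 8)], expanding the square in [v_eta] writes it as
   a combination of truncated moments of [phi] (lemma [v_eta_sqmoment]), which the
   fundamental theorem of calculus differentiates without any derivative of [phi].  The
   lower limit [-2], below the support, keeps [z = -1] away from the boundary. *)
Definition moment (k : nat) (z : R) : R :=
  (\int[mu]_(u in `[-2, z]) (phi u * u ^+ k))%R.

Lemma continuous_mulR (f g : R -> R) : continuous f -> continuous g ->
  continuous (fun u => f u * g u).
Proof. by move=> cf cg u; apply: (@continuousM _ _ f g); [exact: cf|exact: cg]. Qed.

Lemma moment_integrand_continuous k : continuous (fun u : R => phi u * u ^+ k).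
Proof. exact: continuous_mulR phi_cont (@exprn_continuous _ k). Qed.

Lemma continuous_itv_integrable (f : R -> R) (a b : R) : continuous f ->
  mu.-integrable `[a, b] (EFin \o f).
Proof.
move=> cf; apply: continuous_compact_integrable; first exact: segment_compact.
exact: continuous_subspaceT.
Qed.

Lemma moment_eq0 k z : z < -1 -> moment k z = 0.
Proof.
move=> z1; rewrite /moment (@eq_Rintegral _ _ _ _ _ (cst 0)).
  by rewrite Rintegral_cst// mul0r.
move=> u; rewrite inE/= in_itv/= => /andP[_ uz].
rewrite phi_supp ?mul0r// ltr0_norm; lra.
Qed.

Lemma is_derive_moment k (z : R) : is_derive z 1 (moment k) (phi z * z ^+ k).
Proof.
have [z1|z1] := ltP z (-1).
  rewrite phi_supp ?mul0r; last by rewrite ltr0_norm; lra.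
  apply: (@near_eq_is_derive _ _ _ (cst 0)).
  by near=> y; rewrite moment_eq0//; near: y; exact: lt_nbhsl.
have zz1 : z < z + 1 by rewrite ltrDl.
have z2 : -2 < z by lra.
have [dm dm1] := continuous_FTC1_closed zz1
  (continuous_itv_integrable _ _ (@moment_integrand_continuous k)) z2
  (@moment_integrand_continuous k z).
by apply: DeriveDef; [exact: dm|rewrite -derive1E; exact: dm1].
Unshelve. all: by end_near. Qed.

Lemma moment0_1 z : 1 <= z -> moment 0 z = 1.
Proof.
move=> z1; rewrite /moment Rintegral_mkcond /Rintegral.
transitivity (fine (\int[mu]_x (phi x)%:E)%E); last by rewrite phi_int.
congr fine.
apply: eq_integral => u _; congr EFin.
rewrite patchE; case: ifPn => [_|]; first by rewrite expr0 mulr1.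
rewrite notin_setE/= in_itv/= => /negP; rewrite negb_and -!ltNge => uz.
by rewrite phi_supp// ltr_normr; case/orP: uz => ?; apply/orP; [right|left]; lra.
Qed.

(** [phi u * u] is odd: once the domain is cut down to [[-1, 1]], reflection shows that the integral
    equals its opposite. *)
Lemma moment1_eq0 z : 1 <= z -> moment 1 z = 0.
Proof.
move=> z1; have -> : moment 1 z = (\int[mu]_(u in `[-1, 1]) (phi u * u))%R.
  rewrite /moment Rintegral_mkcond [RHS]Rintegral_mkcond.
  apply: eq_Rintegral => u _; rewrite !patchE expr1.
  have [u1|u1] := ltP 1 `|u|; first by rewrite phi_supp// mul0r !if_same.
  move: u1; rewrite ler_norml => /andP[u1 u2].
  by rewrite !mem_set//= in_itv/=; apply/andP; split; lra.
set I := (\int[_]_(_ in _) _)%R; suff : I = - I by lra.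
have cf : continuous (fun u : R => phi u * u).
  by apply: (@continuous_mulR phi id) => // u; exact: cvg_id.
have -> : - I = (\int[mu]_(u in `[-1, 1]) (phi u * u * -1))%R.
  by rewrite RintegralZr ?mulrN1//; exact: continuous_itv_integrable.
rewrite /I /Rintegral; congr fine.
have := @integration_by_substitution_oppr R (fun u => phi u * u) (-1) 1.
rewrite opprK => ->; last 2 first.
- lra.
- exact: continuous_subspaceT.
by apply: eq_integral => u _ /=; rewrite phi_even mulrN mulrN1.
Qed.

Lemma moment0_ge0 z : 0 <= moment 0 z.
Proof. by apply: Rintegral_ge0 => u _; rewrite expr0 mulr1. Qed.

Lemma moment0_le1 z : moment 0 z <= 1.
Proof.
have [z1|z1] := leP 1 z; first by rewrite moment0_1.
have [|c _ H] := @MVT_segment R (moment 0) (fun u => phi u * u ^+ 0) z 1 (ltW z1)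
  (fun u _ => is_derive_moment 0 u).
  by apply: derivable_within_continuous => t _; have [] := is_derive_moment 0 t.
rewrite -(moment0_1 (lexx 1)) -subr_ge0 H mulr_ge0 ?subr_ge0 ?(ltW z1)//.
by rewrite expr0 mulr1.
Qed.

(** Expansion of the integral of [phi u * (z - u) ^+ 2] over [u <= z]. The integrand has a double
    zero at [u = z], so the boundary terms cancel in the first two derivatives. *)
Definition sqmoment (z : R) := z ^+ 2 * moment 0 z - 2 * z * moment 1 z + moment 2 z.
Definition sqmoment1 (z : R) := 2 * (z * moment 0 z - moment 1 z).
Definition sqmoment2 (z : R) := 2 * moment 0 z.

Lemma is_derive_sqmoment (z : R) : is_derive z 1 sqmoment (sqmoment1 z).
Proof.
have d0 := is_derive_moment 0 z; have d1 := is_derive_moment 1 z.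
have d2 := is_derive_moment 2 z.
apply: (@is_derive_eq _ _ _
  ((id ^+ 2 : R -> R) * moment 0 - (2 *: (id : R -> R)) * moment 1 + moment 2)).
by rewrite /GRing.scale/= /sqmoment1 -[_ *: z]/(2 * z) exprfctE; ring.
Qed.

Lemma is_derive_sqmoment1 (z : R) : is_derive z 1 sqmoment1 (sqmoment2 z).
Proof.
have d0 := is_derive_moment 0 z; have d1 := is_derive_moment 1 z.
apply: (@is_derive_eq _ _ _ (2 *: ((id : R -> R) * moment 0 - moment 1))).
by rewrite /GRing.scale/= /sqmoment2; ring.
Qed.

(** The slope lies in [[0, 2]] and [sqmoment1] vanishes at [-2]. Starting from [-2] instead of [-1]
    loses a little, which the later comparison with [2 * t] can afford. *)
Lemma sqmoment1_bounds z : 0 <= sqmoment1 z <= 2 * Num.max 0 (z + 2).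
Proof.
have s0 : sqmoment1 (-2) = 0 by rewrite /sqmoment1 !moment_eq0; [ring|lra..].
have [z2|z2] := leP z (-2).
  rewrite {1 2}/sqmoment1 !moment_eq0; [|lra..].
  by rewrite mulr0 subrr mulr0 lexx mulr_ge0// le_max lexx.
have [|c _ H] := @MVT_segment R sqmoment1 sqmoment2 (-2) z (ltW z2)
  (fun u _ => is_derive_sqmoment1 u).
  by apply: derivable_within_continuous => t _; have [] := is_derive_sqmoment1 t.
move: H; rewrite s0 subr0 opprK => ->.
have m0 := moment0_ge0 c; have m1 := moment0_le1 c.
rewrite max_r; last lra.
rewrite /sqmoment2; apply/andP; split; first by rewrite !mulr_ge0//; lra.
rewrite -mulrA ler_pM2l// ler_piMl//; lra.
Qed.

Lemma gamma_etaE (eta t : R) : gamma_eta eta t = Num.max (t - 5 * eta / 8) 0 ^+ 2.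
Proof.
rewrite /gamma_eta; case: ltP => h; first by rewrite max_r ?expr0n//; lra.
by rewrite max_l//; lra.
Qed.

Lemma gamma_eta_continuous (eta : R) : continuous (@gamma_eta R eta).
Proof.
have -> : @gamma_eta R eta = (fun x => x ^+ 2) \o
    ((fun t => t - 5 * eta / 8) \max (cst 0 : R -> R)).
  by apply/funext => t; rewrite gamma_etaE.
move=> t; apply: continuous_comp; last exact: exprn_continuous.
apply: continuous_max; last exact: cst_continuous.
by apply: continuousB; [exact: cvg_id|exact: cst_continuous].
Qed.

Lemma v_eta_sqmoment (eta t : R) : 0 < eta ->
  v_eta phi eta t = (eta / 8) ^+ 2 * sqmoment ((t - 5 * eta / 8) / (eta / 8)).
Proof.
move=> eta0; set e := eta / 8; set a := 5 * eta / 8; set z := (t - a) / e.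
have e0 : 0 < e by rewrite divr_gt0.
pose G (s : R) : R := mollif phi e (t - s) * gamma_eta eta s.
have cG : continuous G.
  apply: (@continuous_mulR (fun s => mollif phi e (t - s)) (gamma_eta eta));
    last exact: gamma_eta_continuous.
  apply: (@continuous_mulR (cst e^-1) (fun s => phi ((t - s) / e))).
    exact: cst_continuous.
  move=> s; apply: (@continuous_comp _ _ _ (fun s => (t - s) / e) phi).
    apply: (@continuous_mulR (fun s => t - s) (cst e^-1)); last exact: cst_continuous.
    by move=> u; apply: (@continuousB _ _ _ (cst t) id); [exact: cst_continuous|exact: cvg_id].
  exact: phi_cont.
have G0 s : e < `|t - s| -> G s = 0.
  move=> ts; rewrite /G /mollif phi_supp ?mulr0 ?mul0r//.
  by rewrite normrM normfV (gtr0_norm e0) ltr_pdivlMr// mul1r.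
have -> : v_eta phi eta t = (\int[mu]_(s in `[(t - e), (t + e)]) G s)%R.
  rewrite /v_eta [RHS]Rintegral_mkcond; apply: eq_Rintegral => s _.
  rewrite patchE; case: ifPn => // /negP; rewrite inE/= in_itv/= => /negP.
  rewrite negb_and -!ltNge => ts; rewrite -[LHS]/(G s) G0//.
  by rewrite ltr_normr; case/orP: ts => ?; apply/orP; [left|right]; lra.
(* Substitution [s = t - e * u]: its Jacobian [e] cancels the normalisation of the mollifier. *)
pose F (u : R) : R := t - e * u.
have dF (u : R) : is_derive u 1 F (- e).
  apply: (@is_derive_eq _ _ _ (cst t - e *: (id : R -> R))).
  by rewrite /GRing.scale/= mulr1 sub0r.
have F1 : derive1 F = cst (- e).
  by apply/funext => u; rewrite derive1E; have [_ ->] := dF u.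
have cF : continuous F.
  by move=> u; apply/differentiable_continuous/derivable1_diffP; have [] := dF u.
have -> : (\int[mu]_(s in `[(t - e), (t + e)]) G s)%R =
    (\int[mu]_(u in `[-1, 1]) (G (F u) * e))%R.
  rewrite /Rintegral; congr fine.
  have := @integration_by_substitution_decreasing R F G (-1) 1.
  rewrite F1 (_ : F 1 = t - e); last by rewrite /F mulr1.
  rewrite (_ : F (-1) = t + e); last by rewrite /F mulrN1 opprK.
  move=> ->.
  - by apply: eq_integral => u _; rewrite !fctE opprK.
  - by lra.
  - by move=> x y _ _ xy; rewrite /F ltrD2l ltrN2 ltr_pM2l.
  - by move=> u _; exact: cst_continuous.
  - exact: is_cvg_cst.
  - exact: is_cvg_cst.
  - split.
    + by move=> u _; have [] := dF u.
    + by apply: cvg_at_right_filter; exact: cF.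
    + by apply: cvg_at_left_filter; exact: cF.
  - exact: continuous_subspaceT.
(* Both restricted integrands agree pointwise: [phi] vanishes for [|u| > 1], and the truncation in
   [gamma_eta] removes [u > z]. *)
have -> : (\int[mu]_(u in `[-1, 1]) (G (F u) * e))%R =
    (\int[mu]_(u in `[-2, z]) (e ^+ 2 * (phi u * (z - u) ^+ 2)))%R.
  rewrite Rintegral_mkcond [RHS]Rintegral_mkcond; apply: eq_Rintegral => u _.
  have GF : G (F u) * e = phi u * (e * Num.max (z - u) 0) ^+ 2.
    rewrite /G /F /mollif gamma_etaE -/a.
    have -> : t - (t - e * u) = u * e by ring.
    rewrite mulfK ?gt_eqF//.
    have -> : t - e * u - a = e * (z - u) by rewrite /z; field; rewrite gt_eqF.
    have -> : Num.max (e * (z - u)) 0 = e * Num.max (z - u) 0.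
      by rewrite maxr_pMr ?mulr0// ltW.
    by field; rewrite gt_eqF.
  rewrite !patchE GF.
  have [u1|u1] := ltP 1 `|u|.
    by rewrite phi_supp// !mul0r mulr0 !if_same.
  move: u1; rewrite ler_norml => /andP[u1 u2].
  rewrite mem_set/=; last by rewrite in_itv/=; apply/andP; split; lra.
  have [uz|zu] := leP u z.
    rewrite mem_set/=; last by rewrite in_itv/= uz andbT; lra.
    by rewrite max_l ?subr_ge0//; ring.
  rewrite memNset/=; last by rewrite in_itv/= [u <= z]leNgt zu andbF.
  by rewrite max_r ?mulr0 ?expr0n ?mulr0//= subr_le0 ltW.
have ci k := continuous_itv_integrable (-2) z (@moment_integrand_continuous k).
have cm (k : nat) (r : R) : continuous (fun u => r * (phi u * u ^+ k)).
  apply: (@continuous_mulR (cst r) (fun u => phi u * u ^+ k)).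
    exact: cst_continuous.
  exact: moment_integrand_continuous.
have cZ (k : nat) (r : R) :
    mu.-integrable `[-2, z] (EFin \o (fun u => r * (phi u * u ^+ k))).
  exact: continuous_itv_integrable (cm k r).
have -> : (\int[mu]_(u in `[-2, z]) (e ^+ 2 * (phi u * (z - u) ^+ 2)))%R =
    (\int[mu]_(u in `[-2, z]) (((e ^+ 2 * z ^+ 2) * (phi u * u ^+ 0) +
       (- (2 * e ^+ 2 * z)) * (phi u * u ^+ 1)) + e ^+ 2 * (phi u * u ^+ 2)))%R.
  by apply: eq_Rintegral => u _; ring.
rewrite RintegralD//; last first.
  apply: continuous_itv_integrable => u.
  apply: (@continuousD _ _ _ (fun u => e ^+ 2 * z ^+ 2 * (phi u * u ^+ 0))
    (fun u => - (2 * e ^+ 2 * z) * (phi u * u ^+ 1))); exact: cm.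
rewrite RintegralD// !RintegralZl// /sqmoment /moment.
by ring.
Qed.

(** The kink of [gamma_eta] is at [5 eta / 8] and the mollifier reaches [eta / 8] to each side,
    which explains [eta / 2] and [3 eta / 4]. Past the latter all the mass of [phi] is counted, and
    its first moment is zero. *)
Lemma v_eta_spec (eta : R) : 0 < eta -> exists ve1 ve2 : R -> R,
  [/\ forall t : R, is_derive t 1 (v_eta phi eta) (ve1 t),
      forall t : R, is_derive t 1 ve1 (ve2 t),
      forall t, t <= eta / 2 -> v_eta phi eta t = 0,
      forall t, 0 <= t -> 0 <= ve2 t <= 2 /\ 0 <= ve1 t <= 2 * t &
      forall t, 3 * eta / 4 <= t ->
        ve2 t = 2 /\ ve1 t = 2 * (t - 5 * eta / 8)].
Proof.
move=> eta0; set e := eta / 8; set a := 5 * eta / 8.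
have e0 : 0 < e by rewrite divr_gt0.
pose Z (t : R) : R := (t - a) / e.
have dZ (t : R) : is_derive t 1 Z e^-1.
  have -> : Z = e^-1 *: ((id : R -> R) - cst a).
    by apply/funext => s; rewrite /Z mulrC.
  apply: is_derive_eq.
  by rewrite /GRing.scale/= subr0 mulr1.
exists (fun t => e * sqmoment1 (Z t)), (fun t => sqmoment2 (Z t)); split.
- move=> t; have -> : v_eta phi eta = e ^+ 2 *: (sqmoment \o Z).
    by apply/funext => s; rewrite v_eta_sqmoment.
  have dc : is_derive t 1 (sqmoment \o Z) (sqmoment1 (Z t) * e^-1).
    by apply: is_derive1_comp; exact: is_derive_sqmoment.
  apply: is_derive_eq.
  by rewrite /GRing.scale/=; field; rewrite gt_eqF.
- move=> t; have dc : is_derive t 1 (sqmoment1 \o Z) (sqmoment2 (Z t) * e^-1).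
    by apply: is_derive1_comp; exact: is_derive_sqmoment1.
  apply: (@is_derive_eq _ _ _ (e *: (sqmoment1 \o Z))).
  by rewrite /GRing.scale/=; field; rewrite gt_eqF.
- move=> t te; rewrite /v_eta (@eq_Rintegral _ _ _ _ _ (cst 0)).
    by rewrite -[(\int[_]_(_ in _) _)%R]/(fine _) integral0.
  move=> s _ /=; have [ts|ts] := ltP 1 `|(t - s) / (eta / 8)|.
    by rewrite /mollif phi_supp// mulr0 mul0r.
  move: ts; rewrite normrM normfV (gtr0_norm e0) ler_pdivrMr// mul1r ler_norml.
  move=> /andP[ts _]; rewrite gamma_etaE max_r ?expr0n ?mulr0//.
  by move: ts; rewrite /e => ts; lra.
- move=> t t0; split.
    have m0 := moment0_ge0 (Z t); have m1 := moment0_le1 (Z t).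
    by rewrite /sqmoment2; apply/andP; split; lra.
  have /andP[s0 s1] := sqmoment1_bounds (Z t).
  apply/andP; split; first by rewrite mulr_ge0 ?(ltW e0).
  have -> : 2 * t = e * (2 * (t / e)) by field; rewrite gt_eqF.
  rewrite ler_pM2l// (le_trans s1)// ler_pM2l// ge_max divr_ge0 ?(ltW e0)//=.
  rewrite /Z ler_pdivlMr// mulrDl divfK ?gt_eqF//.
  by rewrite /a /e; lra.
- move=> t te; have z1 : 1 <= Z t.
    by rewrite /Z ler_pdivlMr// mul1r /a /e; lra.
  rewrite /sqmoment2 /sqmoment1 moment0_1// moment1_eq0// !mulr1; split=> //.
  by rewrite subr0 /Z; field; rewrite gt_eqF.
Qed.

End Mollification.

(** * Second derivative of the surrogate *)

Section RadialHessian.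
Variables (R : realType) (p : nat).
Implicit Types (x d w : 'cV[R]_p).

(* Second derivative of [psi (enorm x)] in the directions [d] and [w], where [p1] and
   [p2] are [psi'] and [psi''] at [enorm x].  At [x = 0] it is [0], which is right
   because all radial profiles used here are constant near [0]. *)
Definition radial_hess (p1 p2 : R) x d w : R :=
  (p2 - p1 / enorm x) / enorm x ^+ 2 * inner x d * inner x w
  + p1 / enorm x * inner d w.

(** Splitting [d] into its parts along and across [x], the form has eigenvalue [p2] on the first and
    [p1 / enorm x] on the second; [s] is the squared length of the radial part. *)
Lemma radial_hess_ge (k p1 p2 : R) x d : enorm x != 0 ->
  k <= p2 -> k <= p1 / enorm x ->
  k * enorm d ^+ 2 <= radial_hess p1 p2 x d d.
Proof.
move=> r0 kp2 kq; rewrite /radial_hess -sqr_enorm; set r := enorm x in r0 kq *.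
set q := p1 / r in kq *.
have rgt0 : 0 < r by rewrite lt_neqAle eq_sym r0 enorm_ge0.
have c2 : inner x d ^+ 2 <= r ^+ 2 * enorm d ^+ 2.
  rewrite -exprMn -[leLHS]real_normK ?num_real// ler_pXn2r ?nnegrE//.
    exact: CauchySchwarz_norm.
  by rewrite mulr_ge0 ?enorm_ge0.
set c := inner x d in c2 *; set D := enorm d ^+ 2 in c2 *.
set s := c ^+ 2 / r ^+ 2.
have sD : s <= D by rewrite /s ler_pdivrMr ?exprn_gt0// mulrC.
have s0 : 0 <= s by rewrite /s divr_ge0 ?sqr_ge0.
have -> : (p2 - q) / r ^+ 2 * c * c = (p2 - q) * s by rewrite /s; field.
have : k * s <= p2 * s by rewrite ler_wpM2r.
have : k * (D - s) <= q * (D - s) by rewrite ler_wpM2r ?subr_ge0.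
by lra.
Qed.

Lemma radial_hess0 (p1 p2 : R) x d w : enorm x = 0 -> radial_hess p1 p2 x d w = 0.
Proof. by move=> x0; rewrite /radial_hess x0 expr0n/= invr0; ring. Qed.

Lemma normr_inner_div x d : `|inner x d / enorm x| <= enorm d.
Proof.
have [x0|x0] := eqVneq (enorm x) 0.
  by rewrite x0 invr0 mulr0 normr0 enorm_ge0.
have xgt0 : 0 < enorm x by rewrite lt_neqAle eq_sym x0 enorm_ge0.
rewrite normrM normfV (gtr0_norm xgt0) ler_pdivrMr// mulrC.
exact: CauchySchwarz_norm.
Qed.

Lemma normr_radial_hess (p1 p2 : R) x d w :
  `|radial_hess p1 p2 x d w| <=
    (`|p2 - p1 / enorm x| + `|p1 / enorm x|) * (enorm d * enorm w).
Proof.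
have -> : radial_hess p1 p2 x d w =
  (p2 - p1 / enorm x) * ((inner x d / enorm x) * (inner x w / enorm x))
  + p1 / enorm x * inner d w.
  by rewrite /radial_hess expr2 invfM; ring.
rewrite (le_trans (ler_normD _ _))// [leRHS]mulrDl !normrM lerD// ler_wpM2l//.
  by rewrite -!normrM normrM ler_pM// normr_inner_div.
exact: CauchySchwarz_norm.
Qed.

End RadialHessian.

Section Surrogate.
(** Here [u] stands for the rescaled cutoff and [w] for [v_eta]; [M] bounds the cutoff derivatives
    up to powers of [eta], and [G] will bound the gradient of [ell] on [B]. *)
Variables (R : realType) (p : nat) (ell : 'cV[R]_p -> R) (ts ti : 'cV[R]_p).
Variables (eta H G0 m K M : R) (u u1 u2 w w1 w2 : R -> R).
Implicit Types (th d e : 'cV[R]_p).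

Let B := [set th : 'cV[R]_p | enorm (th - ts) <= eta].
Let G := G0 + H * eta.

Hypothesis eta0 : 0 < eta.
Hypothesis tis : enorm (ti - ts) <= eta / 8.
Hypothesis C2ell : C2_on ell B.
Hypothesis gradG0 : enorm (grad ell ts) <= G0.
Hypothesis hessH : forall th, B th -> opnorm (hess ell th) <= H.
Hypothesis hessm : forall th, B th ->
  forall a, eigenvalue (- hess ell th) a -> m <= a.
Hypothesis H0 : 0 <= H.
Hypothesis m0 : 0 <= m.
Hypothesis M0 : 0 <= M.
Hypothesis du : forall t : R, is_derive t 1 u (u1 t).
Hypothesis du1 : forall t : R, is_derive t 1 u1 (u2 t).
Hypothesis u01 : forall t, 0 <= u t <= 1.
Hypothesis u_eq1 : forall t, t <= 3 * eta / 4 -> u t = 1.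
Hypothesis u_eq0 : forall t, 7 * eta / 8 < t -> u t = 0.
Hypothesis u1_bound : forall t, `|u1 t| <= M / eta.
Hypothesis u2_bound : forall t, `|u2 t| <= M / eta ^+ 2.
Hypothesis dw : forall t : R, is_derive t 1 w (w1 t).
Hypothesis dw1 : forall t : R, is_derive t 1 w1 (w2 t).
Hypothesis w_eq0 : forall t, t <= eta / 2 -> w t = 0.
Hypothesis w_bound : forall t, 0 <= t -> 0 <= w2 t <= 2 /\ 0 <= w1 t <= 2 * t.
Hypothesis w_quad : forall t, 3 * eta / 4 <= t ->
  w2 t = 2 /\ w1 t = 2 * (t - 5 * eta / 8).
(** [K / 3] is the curvature supplied by the penalty where [r >= 3 eta / 4]; it pays for the cutoff
    term and leaves [m]. *)
Hypothesis K_large : H + 5 * G * M / eta + m <= K / 3.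

Let G_ge0 : 0 <= G.
Proof.
by rewrite addr_ge0 ?mulr_ge0 ?(ltW eta0)//; exact: le_trans (enorm_ge0 _) gradG0.
Qed.

Let GM_ge0 : 0 <= G * M / eta.
Proof. by rewrite divr_ge0 ?mulr_ge0 ?(ltW eta0). Qed.

Let u1_eq0l t : t < 3 * eta / 4 -> u1 t = 0.
Proof.
by move=> te; apply: (@radial_derivative_eq0 _ u u1 _ 1 du) te => s /ltW /u_eq1.
Qed.

Let u2_eq0l t : t < 3 * eta / 4 -> u2 t = 0.
Proof.
by move=> te; exact: (@radial_derivative_eq0 _ u1 u2 _ 0 du1 u1_eq0l) te.
Qed.

Let u1_eq0r t : 7 * eta / 8 < t -> u1 t = 0.
Proof.
move=> te; apply: (is_derive_near_cst (c := 0) _ (du t)).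
by near=> s; apply: u_eq0; near: s; exact: lt_nbhsr.
Unshelve. all: by end_near. Qed.

Let B_line th t : enorm (th - ti) <= 7 * eta / 8 -> 0 <= t <= 1 ->
  B (ti + t *: (th - ti)).
Proof.
move=> r78 /andP[t0 t1]; rewrite /B /= addrAC.
rewrite (le_trans (ler_enormD _ _))// enormZ ger0_norm//.
have : t * enorm (th - ti) <= enorm (th - ti) by rewrite ler_piMl ?enorm_ge0.
by have := tis; lra.
Qed.

Let B_near_init th : enorm (th - ti) <= 7 * eta / 8 -> B th.
Proof.
move=> r78; have := B_line r78 (t := 1); rewrite scale1r addrC subrK; apply.
by rewrite ler01 lexx.
Qed.

Let grad_bound th : B th -> enorm (grad ell th) <= G.
Proof.
move=> Bth; rewrite -[grad ell th](subrK (grad ell ts)) addrC.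
rewrite (le_trans (ler_enormD _ _))// lerD//.
apply: enorm_le_inner; first by rewrite mulr_ge0// ltW.
move=> e; rewrite innerC innerBr; set d := th - ts.
have Bl t : 0 <= t <= 1 -> B (ts + t *: d).
  move=> /andP[t0 t1]; rewrite /B /= addrC addKr enormZ ger0_norm//.
  by apply: le_trans Bth; rewrite ler_piMl ?enorm_ge0.
have [|c cT] := @MVT_line _ _ (fun y => inner e (grad ell y))
    (fun y => inner e (hess ell y *m d)) ts d 1 ler01.
  move=> t tT; apply: is_derive_inner_grad.
  by have [_ dpf _] := C2ell (Bl t tT).
rewrite scale1r /d [ts + (th - ts)]addrC subrK mul1r => ->.
rewrite (le_trans (CauchySchwarz_inner _ _))// mulrC ler_wpM2r ?enorm_ge0//.
rewrite (le_trans (ler_opnorm _ _))//.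
apply: (@le_trans _ _ (H * enorm d)); last exact: ler_wpM2l.
by apply: ler_wpM2r; [exact: enorm_ge0|exact: hessH (Bl c cT)].
Qed.

Let ell_bound th : enorm (th - ti) <= 7 * eta / 8 ->
  `|ell th - ell ti| <= enorm (th - ti) * G.
Proof.
move=> r78; set d := th - ti.
have [|c cT] := @MVT_line _ _ ell (fun y => inner d (grad ell y)) ti d 1 ler01.
  move=> t tT; have [dl _ _] := C2ell (B_line r78 tT).
  by rewrite inner_grad//; apply: derivableP; exact: diff_derivable.
rewrite scale1r /d [ti + (th - ti)]addrC subrK mul1r => ->.
rewrite (le_trans (CauchySchwarz_norm _ _))// ler_wpM2l ?enorm_ge0//.
exact: grad_bound (B_line r78 cT).
Qed.

Let f th := u (enorm (th - ti)) * (ell th - ell ti) + ell ti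
  - K * w (enorm (th - ti)).

(* Outside the ball [ell] need not be differentiable, but there [u] and [u1] vanish, so
   that this formula for the derivative of [f] holds everywhere. *)
Let D1 d th := u (enorm (th - ti)) * inner d (grad ell th)
  + (ell th - ell ti) *
    (u1 (enorm (th - ti)) / enorm (th - ti) * inner (th - ti) d)
  - K * (w1 (enorm (th - ti)) / enorm (th - ti) * inner (th - ti) d).

Let D2 d e th := let x := th - ti in let r := enorm x in
  u r * inner e (hess ell th *m d)
  + inner e (grad ell th) * (u1 r / r * inner x d)
  + inner d (grad ell th) * (u1 r / r * inner x e)
  + (ell th - ell ti) * radial_hess (u1 r) (u2 r) x d e
  - K * radial_hess (w1 r) (w2 r) x d e.

Let eta34 : 0 < 3 * eta / 4. Proof. by have := eta0; lra. Qed.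
Let eta12 : 0 < eta / 2. Proof. by have := eta0; lra. Qed.

Let u_cst t : t < 3 * eta / 4 -> u t = 1.
Proof. by move=> /ltW /u_eq1. Qed.

Let u2_eq0r t : 7 * eta / 8 < t -> u2 t = 0.
Proof.
move=> te; apply: (is_derive_near_cst (c := 0) _ (du1 t)).
by near=> s; apply: u1_eq0r; near: s; exact: lt_nbhsr.
Unshelve. all: by end_near. Qed.

Let w_cst t : t < eta / 2 -> w t = 0.
Proof. by move=> /ltW /w_eq0. Qed.

Let enorm_cont : continuous (fun th : 'cV[R]_p => enorm (th - ti)).
Proof.
move=> th.
have cq := differentiable_continuous (differentiable_sqr_dist ti th).
exact: (continuous_comp cq (@sqrt_continuous R _)).
Qed.

Let near_far th : 7 * eta / 8 < enorm (th - ti) ->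
  \forall y \near th, 7 * eta / 8 < enorm (y - ti).
Proof. by move=> h; apply: (cvgr_gt _ (enorm_cont (x := th))). Qed.

Let f_far th : 7 * eta / 8 < enorm (th - ti) ->
  \forall y \near th, ell ti - K * w (enorm (y - ti)) = f y.
Proof.
by move=> /near_far; apply: filterS => y hy; rewrite /f u_eq0// mul0r add0r.
Qed.

Let dfu th : differentiable (fun y => u (enorm (y - ti))) th.
Proof. exact: (differentiable_radial ti eta34 du u_cst). Qed.

Let dfw th : differentiable (fun y => w (enorm (y - ti))) th.
Proof. exact: (differentiable_radial ti eta12 dw w_cst). Qed.

Lemma surrogate_differentiable th : differentiable f th.
Proof.
have dKw : differentiable (K *: (fun y => w (enorm (y - ti)))) th.
  exact: differentiableZ.
(* The sphere itself goes to the case where [ell] is differentiable, so that the other case is open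
   and [f] may be replaced locally. *)
have [r78|r78] := leP (enorm (th - ti)) (7 * eta / 8).
  have [dl _ _] := C2ell (B_near_init r78).
  apply: (@differentiableB _ _ _
    ((fun y => u (enorm (y - ti))) * (ell - cst (ell ti)) + cst (ell ti))
    (K *: (fun y => w (enorm (y - ti))))) => //.
  apply: differentiableD => //.
  by apply: differentiableM => //; exact: differentiableB.
apply: (near_eq_differentiable (f_far r78)).
exact: (@differentiableB _ _ _ (cst (ell ti)) (K *: (fun y => w (enorm (y - ti))))).
Qed.

Let f_D1 th d : 'D_d f th = D1 d th.
Proof.
suff [] : is_derive th d f (D1 d th) by [].
have iu := is_derive_radial ti eta34 du u_cst th d.
have iw := is_derive_radial ti eta12 dw w_cst th d.
have [r78|r78] := leP (enorm (th - ti)) (7 * eta / 8).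
  have [dl _ _] := C2ell (B_near_init r78).
  have il := derivableP (diff_derivable (v := d) dl).
  apply: (@is_derive_eq _ _ _
    ((fun y => u (enorm (y - ti))) * (ell - cst (ell ti)) + cst (ell ti)
     - K *: (fun y => w (enorm (y - ti))))).
  by rewrite /D1 inner_grad// subr0 addr0.
apply: (near_eq_is_derive (f_far r78)).
apply: (@is_derive_eq _ _ _ (cst (ell ti) - K *: (fun y => w (enorm (y - ti))))).
by rewrite /D1 u_eq0// u1_eq0r// !mul0r mulr0 addr0.
Qed.

Let D1_D2 th d e : is_derive th d (D1 e) (D2 d e th).
Proof.
have iw2 := is_derive_radial2 ti eta12 dw dw1 w_cst th d e.
have [r78|r78] := leP (enorm (th - ti)) (7 * eta / 8).
  have [dl dpl _] := C2ell (B_near_init r78).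
  have il := derivableP (diff_derivable (v := d) dl).
  have iu := is_derive_radial ti eta34 du u_cst th d.
  have iu2 := is_derive_radial2 ti eta34 du du1 u_cst th d e.
  have ig := is_derive_inner_grad d e dpl.
  have ilc := is_deriveB il (is_derive_cst (ell ti) th d).
  have H1 := is_deriveD (is_deriveM iu ig) (is_deriveM ilc iu2).
  apply: (is_derive_eq (is_deriveB H1 (is_deriveZ K iw2))).
  rewrite /D2 /radial_hess (inner_grad d dl) subr0 /GRing.scale/=.
  by rewrite [_ * 'D_d ell th]mulrC [X in _ + X - _]addrC addrA.
have far : \forall y \near th,
    (- K *: (fun y => w1 (enorm (y - ti)) / enorm (y - ti) * inner (y - ti) e)) y
    = D1 e y.
  apply: filterS (near_far r78) => y hy.
  by rewrite /D1 u_eq0// u1_eq0r// !mul0r mulr0 !add0r -mulNr.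
apply: (near_eq_is_derive far).
apply: (is_derive_eq (is_deriveZ (- K) iw2)).
rewrite /D2 /radial_hess u_eq0// u1_eq0r// u2_eq0r// /GRing.scale/=.
by rewrite !(mul0r, mulr0, subr0, addr0, add0r) mulNr.
Qed.

Let T := H + 5 * G * M / eta.

Let inner_hess_le th d e : B th ->
  `|inner e (hess ell th *m d)| <= H * (enorm d * enorm e).
Proof.
move=> Bth; rewrite (le_trans (CauchySchwarz_norm _ _))// mulrC mulrA.
apply: ler_wpM2r; first exact: enorm_ge0.
rewrite (le_trans (ler_opnorm _ _))//.
by apply: ler_wpM2r; [exact: enorm_ge0|exact: hessH].
Qed.

(* The factor [1 / r] in [radial_hess] is absorbed by [|ell th - ell ti| <= r * G]. *)
Let cutoff_bound th d e (x := th - ti) (r := enorm x) :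
  `|u r * inner e (hess ell th *m d)
    + inner e (grad ell th) * (u1 r / r * inner x d)
    + inner d (grad ell th) * (u1 r / r * inner x e)
    + (ell th - ell ti) * radial_hess (u1 r) (u2 r) x d e|
  <= T * (enorm d * enorm e).
Proof.
set P := enorm d * enorm e.
have P0 : 0 <= P by rewrite mulr_ge0 ?enorm_ge0.
have T0 : 0 <= 5 * G * M / eta by have := GM_ge0; lra.
have [r78|r78] := ltP (7 * eta / 8) r.
  rewrite /radial_hess u_eq0// u1_eq0r// u2_eq0r//.
  by rewrite !(mul0r, mulr0, subr0, addr0) normr0 mulr_ge0// addr_ge0.
have Bth := B_near_init r78.
have hH : `|u r * inner e (hess ell th *m d)| <= H * P.
  have /andP[u_ge0 u_le1] := u01 r.
  rewrite normrM (ger0_norm u_ge0) (le_trans _ (inner_hess_le d e Bth))//.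
  by rewrite ler_piMl.
have GP y z : `|inner y (grad ell th) * (u1 r / r * inner x z)|
    <= G * M / eta * (enorm y * enorm z).
  have -> : G * M / eta * (enorm y * enorm z) =
      (enorm y * G) * (M / eta * enorm z) by ring.
  have -> : u1 r / r * inner x z = u1 r * (inner x z / r) by ring.
  rewrite normrM [X in _ * X <= _]normrM; apply: ler_pM; rewrite ?mulr_ge0//.
    rewrite (le_trans (CauchySchwarz_norm _ _))// ler_wpM2l ?enorm_ge0//.
    exact: grad_bound.
  by apply: ler_pM; rewrite ?normr_inner_div.
(* The [3] counts [r * |u2|] once and [r * |u1 / r|] twice, each at most [M / eta]; the two mixed
   terms bring the total to [5]. *)
have QP : `|(ell th - ell ti) * radial_hess (u1 r) (u2 r) x d e|
    <= 3 * (G * M / eta) * P.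
  rewrite normrM.
  have := normr_radial_hess (u1 r) (u2 r) x d e; rewrite -/r -/P => Q1.
  apply: (@le_trans _ _ (r * G * ((`|u2 r - u1 r / r| + `|u1 r / r|) * P))).
    by apply: ler_pM => //; exact: ell_bound.
  rewrite [leLHS]mulrA; apply: ler_wpM2r => //.
  have rr : r * `|u1 r / r| <= M / eta.
    have [->|r0] := eqVneq r 0; first by rewrite mul0r divr_ge0 ?(ltW eta0).
    have rgt0 : 0 < r by rewrite lt_neqAle eq_sym r0 enorm_ge0.
    by rewrite normrM normfV (gtr0_norm rgt0) mulrC divfK ?u1_bound.
  have r2 : r * `|u2 r| <= M / eta.
    apply: (@le_trans _ _ (eta * (M / eta ^+ 2))).
      apply: ler_pM => //; first exact: enorm_ge0.
      by have := eta0; lra.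
    by rewrite le_eqVlt; apply/orP; left; apply/eqP; field; rewrite gt_eqF.
  have r3 : r * `|u2 r - u1 r / r| <= r * `|u2 r| + r * `|u1 r / r|.
    by rewrite -mulrDr ler_wpM2l ?enorm_ge0// ler_normB.
  have -> : r * G * (`|u2 r - u1 r / r| + `|u1 r / r|) =
    G * (r * `|u2 r - u1 r / r| + r * `|u1 r / r|) by ring.
  have -> : 3 * (G * M / eta) = G * (3 * (M / eta)) by ring.
  by rewrite ler_wpM2l//; lra.
have := GP e d; have := GP d e; rewrite (mulrC (enorm e)) -/P => G1 G2.
rewrite (le_trans (ler_normD _ _))//.
rewrite (le_trans (lerD (ler_normD _ _) (lexx _)))//.
rewrite (le_trans (lerD (lerD (ler_normD _ _) (lexx _)) (lexx _)))//.
apply: (le_trans (lerD (lerD (lerD hH G2) G1) QP)).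
by rewrite /T; lra.
Qed.

Let w_radial_bounds th (r := enorm (th - ti)) :
  0 <= w2 r <= 2 /\ 0 <= w1 r / r <= 2.
Proof.
have [wb /andP[w1a w1b]] := w_bound (enorm_ge0 (th - ti)); split => //.
have [r0|r0] := eqVneq r 0; first by rewrite r0 invr0 mulr0 lexx ler0n.
have rgt0 : 0 < r by rewrite lt_neqAle eq_sym r0 enorm_ge0.
apply/andP; split; first exact: divr_ge0 w1a (ltW rgt0).
by rewrite ler_pdivrMr.
Qed.

Let K_ge0 : 0 <= K.
Proof. by have := K_large; have := GM_ge0; have := H0; have := m0; lra. Qed.

Lemma surrogate_strongly_concave : strongly_concave m f.
Proof.
apply: (strongly_concave_second_derivative surrogate_differentiable f_D1 D1_D2).
move=> th d; rewrite /D2; set x := th - ti; set r := enorm x.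
have [/andP[w20 w22] /andP[q0 q2]] := w_radial_bounds th.
have D0 : 0 <= enorm d ^+ 2 by rewrite sqr_ge0.
have [r34|r34] := ltP r (3 * eta / 4).
  have Bth : B th by apply: B_near_init; have := eta0; rewrite -/x -/r; lra.
  rewrite u_eq1 ?(ltW r34)// u1_eq0l// u2_eq0l// /radial_hess.
  rewrite !(mul0r, mulr0, subr0, addr0, mul1r).
  have hm : m * enorm d ^+ 2 <= inner d (- hess ell th *m d).
    apply: eigenvalue_lower_bound_inner; last exact: hessm.
    rewrite linearN/= hess_sym//; last by have [] := C2ell Bth.
    (* Symmetry of the Hessian needs differentiability on a neighbourhood, so [th] must be interior
       to [B]: [3 eta / 4 + eta / 8 < eta]. *)
    have th34 : enorm (th - ts) < eta.
      have := ler_enormD x (ti - ts); rewrite /x subrKA -/x -/r.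
      by have := tis; have := eta0; lra.
    have cts : {for th, continuous (fun y : 'cV[R]_p => enorm (y - ts))}.
      have cq := differentiable_continuous (differentiable_sqr_dist ts th).
      exact: (continuous_comp cq (@sqrt_continuous R _)).
    apply: filterS (cvgr_lt _ cts _ th34) => y yB.
    by have [] := C2ell (ltW yB : B y).
  have hw : 0 <= K * radial_hess (w1 r) (w2 r) x d d.
    have [r0|r0] := eqVneq r 0; first by rewrite radial_hess0// mulr0.
    rewrite mulr_ge0// -(mul0r (enorm d ^+ 2)).
    exact: radial_hess_ge.
  by move: hm hw; rewrite mulNmx innerNr /radial_hess; lra.
have rgt0 : 0 < r by have := eta0; lra.
have [w2r w1r] := w_quad r34.
(* The tangential eigenvalue is the smaller one: [w1 r / r = 2 (1 - 5 eta / (8 r))] is at least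
   [2 (1 - 5 / 6) = 1 / 3]. *)
have hw : 3^-1 * enorm d ^+ 2 <= radial_hess (w1 r) (w2 r) x d d.
  apply: radial_hess_ge; first by rewrite gt_eqF.
    by rewrite w2r; lra.
  by rewrite -/r ler_pdivlMr// w1r; lra.
have Khw : K * (3^-1 * enorm d ^+ 2) <= K * radial_hess (w1 r) (w2 r) x d d.
  exact: ler_wpM2l.
have /= := cutoff_bound th d d; rewrite -/x -/r -expr2 => /ler_normlW hT.
have := ler_wpM2r D0 K_large; rewrite -/T mulrDl.
by move: hT Khw; lra.
Qed.

Lemma surrogate_lipschitz_grad : lipschitz_grad (7 * K) f.
Proof.
apply: (lipschitz_grad_second_derivative surrogate_differentiable f_D1 D1_D2).
  by rewrite mulr_ge0.
move=> th d e; rewrite /D2; set x := th - ti; set r := enorm x.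
have [/andP[w20 w22] /andP[q0 q2]] := w_radial_bounds th.
have P0 : 0 <= enorm d * enorm e by rewrite mulr_ge0 ?enorm_ge0.
have /= := cutoff_bound th d e; rewrite -/x -/r => /ler_normlW hT.
(* The penalty contributes at most [4 K] and the cutoff term at most [K / 3], within [7 K]. *)
have : - (K * radial_hess (w1 r) (w2 r) x d e) <= K * (4 * (enorm d * enorm e)).
  rewrite -mulrN ler_wpM2l// lerNl.
  have := normr_radial_hess (w1 r) (w2 r) x d e; rewrite -/r => Q1.
  have : `|w2 r - w1 r / r| + `|w1 r / r| <= 4.
    rewrite (ger0_norm q0) -lerBrDr ler_norml; apply/andP; split; lra.
  move=> /(ler_wpM2r P0) /(le_trans Q1).
  by rewrite ler_norml => /andP[].
have := ler_wpM2r P0 K_large; rewrite -/T mulrDl.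
have := mulr_ge0 m0 P0; have := mulr_ge0 K_ge0 P0.
by move: hT; rewrite -mulrA; lra.
Qed.

End Surrogate.

(** * Cutoff bounds and constants *)

Section Sums.
Variables (R : realType) (p : nat) (f g : 'cV[R]_p -> R) (c : R).
Hypothesis df : forall th, differentiable f th.
Hypothesis dg : forall th, differentiable g th.
Let h th := f th + g th - c.

Let dfg th : differentiable (f + g) th.
Proof. exact: differentiableD. Qed.

Lemma differentiableD_cst th : differentiable h th.
Proof. exact: (@differentiableB _ _ _ (f + g) (cst c)). Qed.

Lemma gradD_cst th : grad h th = grad f th + grad g th.
Proof.
apply/matrixP => i j; rewrite !mxE /partial.
rewrite [LHS](@deriveB _ _ _ (f + g) (cst c)); [|exact: diff_derivable..].
by rewrite derive_cst subr0 deriveD//; exact: diff_derivable.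
Qed.

Lemma strongly_concaveD_cst m1 m2 : strongly_concave m1 f -> strongly_concave m2 g ->
  strongly_concave (m1 + m2) h.
Proof.
move=> cf cg th th'; have := cf th th'; have := cg th th'.
by rewrite gradD_cst innerDr /h; lra.
Qed.

Lemma lipschitz_gradD_cst L1 L2 : lipschitz_grad L1 f -> lipschitz_grad L2 g ->
  lipschitz_grad (L1 + L2) h.
Proof.
move=> lf lg th th'; rewrite !gradD_cst opprD addrACA mulrDl.
by rewrite (le_trans (ler_enormD _ _))// lerD.
Qed.

End Sums.

Section Cutoff.
Variables (R : realType) (v : R -> R).
Hypothesis vs : smooth v.

Lemma is_derive_derive1n k (t : R) : is_derive t 1 (derive1n k v) (derive1n k.+1 v t).
Proof.
by apply: DeriveDef; [exact: vs|rewrite derive1nS derive1E].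
Qed.

Lemma derive1n_continuous k : continuous (derive1n k v).
Proof. by move=> t; apply/differentiable_continuous/derivable1_diffP; exact: vs. Qed.

(** The extreme value theorem on [[a, b]] gives the upper bound without which [sup] says nothing. It
    is meant for the derivatives of [v], which, unlike [v], vanish on both sides. *)
Lemma ler_sup_norm (f : R -> R) (a b : R) : a <= b -> continuous f ->
  (forall t, t < a -> f t = 0) -> (forall t, b < t -> f t = 0) ->
  forall t, `|f t| <= sup (range (fun t => `|f t|)).
Proof.
move=> ab cf f0a f0b t; apply: ub_le_sup; last by exists t.
have cn : continuous (fun t => `|f t|).
  by move=> s; apply: (@continuous_comp _ _ _ f Num.norm); [exact: cf|exact: norm_continuous].
have [c _ fc] := EVT_max ab (continuous_subspaceT cn).
exists `|f c| => _ [s _ <-].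
have [sa|sa] := ltP s a; first by rewrite f0a// normr0.
have [sb|sb] := ltP b s; first by rewrite f0b// normr0.
by apply: fc; rewrite in_itv/= sa.
Qed.

Hypothesis v01 : forall t, 0 <= v t <= 1.
Hypothesis v_eq1 : forall t, t <= 3 / 4 -> v t = 1.
Hypothesis v_eq0 : forall t, 7 / 8 < t -> v t = 0.

Let v1_eq0l t : t < 3 / 4 -> derive1n 1 v t = 0.
Proof.
move=> te; apply: (is_derive_near_cst (c := 1) _ (is_derive_derive1n 0 t)).
by near=> s; apply: v_eq1; apply: ltW; near: s; exact: lt_nbhsl.
Unshelve. all: by end_near. Qed.

Let v1_eq0r t : 7 / 8 < t -> derive1n 1 v t = 0.
Proof.
move=> te; apply: (is_derive_near_cst (c := 0) _ (is_derive_derive1n 0 t)).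
by near=> s; apply: v_eq0; near: s; exact: lt_nbhsr.
Unshelve. all: by end_near. Qed.

Let v2_eq0l t : t < 3 / 4 -> derive1n 2 v t = 0.
Proof.
move=> te; apply: (is_derive_near_cst (c := 0) _ (is_derive_derive1n 1 t)).
by near=> s; apply: v1_eq0l; near: s; exact: lt_nbhsl.
Unshelve. all: by end_near. Qed.

Let v2_eq0r t : 7 / 8 < t -> derive1n 2 v t = 0.
Proof.
move=> te; apply: (is_derive_near_cst (c := 0) _ (is_derive_derive1n 1 t)).
by near=> s; apply: v1_eq0r; near: s; exact: lt_nbhsr.
Unshelve. all: by end_near. Qed.

Lemma C2norm_bounds : [/\ 1 <= C2norm v, forall t, `|derive1n 1 v t| <= C2norm v &
  forall t, `|derive1n 2 v t| <= C2norm v].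
Proof.
have ab : 3 / 4 <= 7 / 8 :> R by lra.
split=> [|t|t]; rewrite /C2norm !le_max.
- apply/orP; left; rewrite -[leLHS]normr1 -(@v_eq1 0); last by lra.
  apply: ub_le_sup; last by exists 0.
  by exists 1 => _ [s _ <-]; have /andP[v0 v1] := v01 s; rewrite ger0_norm.
- apply/orP; right; apply/orP; left.
  exact: (ler_sup_norm ab (@derive1n_continuous 1) v1_eq0l v1_eq0r).
- apply/orP; right; apply/orP; right.
  exact: (ler_sup_norm ab (@derive1n_continuous 2) v2_eq0l v2_eq0r).
Qed.

Lemma is_derive_cutoff (eta : R) k (t : R) :
  is_derive t 1 (fun s => derive1n k v (s / eta) / eta ^+ k)
    (derive1n k.+1 v (t / eta) / eta ^+ k.+1).
Proof.
have dc : is_derive t 1 (derive1n k v \o (fun s => s / eta))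
    (derive1n k.+1 v (t / eta) * eta^-1).
  apply: is_derive1_comp; first exact: is_derive_derive1n.
  have -> : (fun s => s / eta) = eta^-1 *: (id : R -> R).
    by apply/funext => s; rewrite mulrC.
  by apply: is_derive_eq; rewrite /GRing.scale/= mulr1.
have -> : (fun s => derive1n k v (s / eta) / eta ^+ k) =
    (eta ^+ k)^-1 *: (derive1n k v \o (fun s => s / eta)).
  by apply/funext => s; rewrite mulrC.
apply: (is_derive_eq (is_deriveZ _ dc)).
by rewrite /GRing.scale/= exprSr invfM; ring.
Qed.

End Cutoff.

(** Follows from [1 - 1 / 2 <= expR (- 1 / 2)]; for [n >= 2] it turns the rate condition into
    [delta * p ^ k1 <= 2 * eta]. *)
Lemma ln2_ge_half (R : realType) : 2^-1 <= ln (2 : R).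
Proof.
rewrite -[leLHS]expRK ler_ln ?posrE ?expR_gt0//.
have : 1 + - 2^-1 <= expR (- 2^-1 : R) by exact: expR_ge1Dx.
rewrite expRN => h; rewrite -[leRHS]invrK -[leLHS]invrK lef_pV2 ?posrE ?invr_gt0 ?expR_gt0//.
by apply: le_trans h; lra.
Qed.

(** With [c = c_max * n] and [q = p ^ k2], the three terms are at most [c * q],
    [10 * c * (1 + q) * M] and [c], together [11 * c * (1 + q) * M], whereas [K / 3] is at least
    [20 * c * (1 + q) * M]. *)
Lemma penalty_dominates (R : realType) (n p : nat)
  (delta eta c_min c_max k1 k2 k3 K M : R) :
  let pR := p%:R : R in let nR := n%:R : R in
  (2 <= n)%N -> (0 < p)%N -> 0 < delta -> 0 < eta -> 0 < c_min ->
  c_min <= c_max -> 0 <= k3 -> 1 <= M ->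
  ln nR * (delta * pR `^ (k1 + k3)) <= eta ->
  60 * c_max * M * nR * (1 + pR `^ k2) <= K ->
  c_max * nR * pR `^ k2
  + 5 * (c_max * nR * delta * pR `^ k1 + c_max * nR * pR `^ k2 * eta) * M / eta
  + c_min * nR * pR `^ (- k3) <= K / 3.
Proof.
move=> pR nR hn hp delta0 eta0 cmin0 cmm k3_ge0 M1 rate KM.
have p1 : 1 <= pR by rewrite ler1n.
have n0 : 0 < nR by rewrite ltr0n (leq_trans _ hn).
have q0 : 0 <= pR `^ k2 by exact: powR_ge0.
have d2 : delta * pR `^ k1 <= 2 * eta.
  apply: (@le_trans _ _ (delta * pR `^ (k1 + k3))).
    by rewrite ler_pM2l// ler_powR// lerDl.
  set D := delta * _ in rate *.
  have D0 : 0 <= D by rewrite mulr_ge0 ?powR_ge0// ltW.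
  have l2 : 2^-1 <= ln nR.
    apply: le_trans (ln2_ge_half R) _.
    by rewrite ler_ln ?posrE// ler_nat.
  have := ler_wpM2r D0 l2; have := rate; lra.
have pk3 : pR `^ (- k3) <= 1.
  by rewrite -(powRr0 pR) ler_powR// oppr_le0.
set q := pR `^ k2 in q0 KM *.
set c := c_max * nR in KM *.
have c0 : 0 < c by rewrite mulr_gt0// (lt_le_trans cmin0).
have mc : c_min * nR * pR `^ (- k3) <= c.
  apply: (@le_trans _ _ (c_min * nR)); last by rewrite ler_pM2r.
  by rewrite ler_piMr// mulr_ge0 ?(ltW cmin0) ?(ltW n0).
have Gb : c * delta * pR `^ k1 + c * q * eta <= 2 * c * (1 + q) * eta.
  rewrite -[c * delta * _]mulrA.
  have := ler_wpM2l (ltW c0) d2.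
  have := mulr_ge0 (mulr_ge0 (ltW c0) q0) (ltW eta0).
  by lra.
have Tb : 5 * (c * delta * pR `^ k1 + c * q * eta) * M / eta
    <= 10 * (c * (1 + q)) * M.
  rewrite ler_pdivrMr//.
  have -> : 10 * (c * (1 + q)) * M * eta = 5 * (2 * c * (1 + q) * eta) * M by ring.
  by rewrite ler_wpM2r ?ler_wpM2l// (le_trans _ M1).
have cM : c * (1 + q) <= c * (1 + q) * M.
  by rewrite ler_peMr// mulr_ge0 ?addr_ge0 ?(ltW c0).
have KE : 60 * (c * (1 + q) * M) <= K.
  by apply: le_trans KM; rewrite /c le_eqVlt; apply/orP; left; apply/eqP; ring.
have cq : 0 <= c * (1 + q) by rewrite mulr_ge0 ?addr_ge0 ?(ltW c0).
by lra.
Qed.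

Theorem theorem3p2
  (R : realType) (n p : nat) (hn : (2 <= n)%N) (hp : (0 < p)%N)
  (* data, model densities and the log-likelihood l_n *)
  (Zt : Type) (dens : 'cV[R]_p -> Zt -> R) (Z : 'I_n -> Zt)
  (* prior density pi (Assumption (B)) *)
  (pi : 'cV[R]_p -> R) (m_pi L_pi : R)
  (* constants of Assumptions (A), (C), (D) *)
  (th_star th_init : 'cV[R]_p) (delta beta eta c_min c_max k1 k2 k3 K C : R)
  (* surrogate ingredients *)
  (v phi : R -> R) :
  let ell := loglik dens Z in
  let B := [set th : 'cV[R]_p | enorm (th - th_star) <= eta] in
  let pR := (p%:R : R) in
  let nR := (n%:R : R) in
  let tdelta := Num.max (delta `^ (beta^-1)) (delta * pR `^ (k1 + k3)) in
  let tl := tilde_ell v (v_eta phi eta) eta K ell th_init in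
  (* Assumption (A): the relevant constants *)
  0 < delta -> 1 <= beta ->
  (* Assumption (B) *)
  (forall th, 0 < pi th) -> 0 < m_pi ->
  (forall th, differentiable (fun x => ln (pi x)) th) ->
  strongly_concave m_pi (fun x => ln (pi x)) ->
  lipschitz_grad L_pi (fun x => ln (pi x)) ->
  (* Assumption (C) (deterministic part), realized on the event E *)
  0 < eta <= 1 -> 0 < c_min <= c_max -> 0 <= k1 -> 0 <= k2 -> 0 <= k3 ->
  C2_on ell B ->
  enorm (grad ell th_star) <= c_max * nR * delta * pR `^ k1 ->
  (forall th, B th -> opnorm (hess ell th) <= c_max * nR * pR `^ k2) ->
  (forall th, B th -> forall a, eigenvalue (- hess ell th) a ->
       c_min * nR * pR `^ (- k3) <= a) ->
  (* surrogate ingredients: v and phi *)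
  smooth v -> (forall t, 0 <= v t <= 1) ->
  (forall t, t <= 3 / 4 -> v t = 1) -> (forall t, 7 / 8 < t -> v t = 0) ->
  smooth phi -> (forall x, 0 <= phi x) -> (forall x, phi (- x) = phi x) ->
  (forall x, 1 < `|x| -> phi x = 0) ->
  (\int[lebesgue_measure]_x (phi x)%:E = 1)%E ->
  (* Assumption (D) *)
  enorm (th_init - th_star) <= eta / 8 ->
  0 < C -> pR <= C * nR * delta ^+ 2 ->
  ln nR * tdelta <= eta ->
  60 * c_max * C2norm v * nR * (1 + pR `^ k2) <= K ->
  (* conclusions *)
  [/\ (* (i) *)
      (forall th, enorm (th - th_star) <= 3 * eta / 8 -> ell th = tl th),
      (* (ii) *)
      (forall th, differentiable tl th) /\
      strongly_concave (c_min * nR * pR `^ (- k3)) tl /\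
      lipschitz_grad (7 * K) tl &
      (* in particular: log tilde-pi(. | Z) = tl + log pi - (log normalising constant) *)
      forall c : R,
        let lpost := fun th => tl th + ln (pi th) - c in
        (forall th, differentiable lpost th) /\
        strongly_concave (c_min * nR * pR `^ (- k3) + m_pi) lpost /\
        lipschitz_grad (7 * K + L_pi) lpost].
Proof.
move=> ell B pR nR tdelta tl delta0 beta1 pi0 m_pi0 dpi cpi lpi /andP[eta0 eta1]
  /andP[cmin0 cmm] k1_ge0 k2_ge0 k3_ge0 C2ell gradG hessH hessm vs v01 v1 v0
  phis phi0 phie phisupp phiint tis C0 pC rate KM.
have [M1 vb1 vb2] := C2norm_bounds vs v01 v1 v0.
have phic : continuous phi := derive1n_continuous phis (k := 0).
have [ve1 [ve2 [dve dve1 ve_eq0 ve_b ve_q]]] :=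
  v_eta_spec phic phi0 phie phisupp phiint eta0.
have cmax0 : 0 < c_max by exact: lt_le_trans cmin0 cmm.
have n0 : 0 <= nR by exact: ler0n.
have rate' : ln nR * (delta * pR `^ (k1 + k3)) <= eta.
  apply: le_trans rate; rewrite ler_wpM2l ?le_max ?lexx ?orbT//.
  by rewrite ln_ge0// ler1n (leq_trans _ hn).
have HK := penalty_dominates hn hp delta0 eta0 cmin0 cmm k3_ge0 M1 rate' KM.
have H0 : 0 <= c_max * nR * pR `^ k2.
  by rewrite mulr_ge0 ?powR_ge0// mulr_ge0// ltW.
have m0 : 0 <= c_min * nR * pR `^ (- k3).
  by rewrite mulr_ge0 ?powR_ge0// mulr_ge0// ltW.
have M0 : 0 <= C2norm v by exact: le_trans M1.
pose u t := v (t / eta).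
have du (t : R) : is_derive t 1 u (derive1n 1 v (t / eta) / eta ^+ 1).
  have -> : u = (fun s => derive1n 0 v (s / eta) / eta ^+ 0).
    by apply/funext => s; rewrite expr0 divr1.
  exact: is_derive_cutoff.
have du1 (t : R) : is_derive t 1 (fun s => derive1n 1 v (s / eta) / eta ^+ 1)
    (derive1n 2 v (t / eta) / eta ^+ 2).
  exact: is_derive_cutoff.
have u_eq1 t : t <= 3 * eta / 4 -> u t = 1.
  by move=> te; apply: v1; rewrite ler_pdivrMr//; lra.
have u_eq0 t : 7 * eta / 8 < t -> u t = 0.
  by move=> te; apply: v0; rewrite ltr_pdivlMr//; lra.
have ub (k : nat) (b t : R) : `|t| <= b -> `|t / eta ^+ k| <= b / eta ^+ k.
  by move=> tb; rewrite normrM normfV (gtr0_norm (exprn_gt0 _ eta0)) ler_pM2r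
    ?invr_gt0 ?exprn_gt0.
have u1b t := ub 1 _ _ (vb1 (t / eta)).
have u2b t := ub 2 _ _ (vb2 (t / eta)).
have u01 t : 0 <= u t <= 1 by exact: v01.
have dtl : forall th, differentiable tl th.
  exact: (surrogate_differentiable K eta0 tis C2ell du u_eq1 u_eq0 dve ve_eq0).
have ctl : strongly_concave (c_min * nR * pR `^ (- k3)) tl.
  exact: (surrogate_strongly_concave eta0 tis C2ell gradG hessH hessm H0 m0 M0
    du du1 u01 u_eq1 u_eq0 u1b u2b dve dve1 ve_eq0 ve_b ve_q HK).
have ltl : lipschitz_grad (7 * K) tl.
  exact: (surrogate_lipschitz_grad eta0 tis C2ell gradG hessH H0 m0 M0
    du du1 u01 u_eq1 u_eq0 u1b u2b dve dve1 ve_eq0 ve_b HK).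
split.
- move=> th th38.
  (* [3 eta / 8 + eta / 8 = eta / 2], the radius up to which the penalty vanishes; the cutoff is
     still [1] there. *)
  have r2 : enorm (th - th_init) <= eta / 2.
    have := ler_enormD (th - th_star) (th_star - th_init).
    by rewrite subrKA (enormB th_star); lra.
  rewrite /tl /tilde_ell -[v _]/(u _) u_eq1; last by lra.
  by rewrite ve_eq0// mul1r subrK mulr0 subr0.
- by [].
- move=> c lpost; split; first exact: differentiableD_cst.
  split; first exact: strongly_concaveD_cst.
  exact: lipschitz_gradD_cst.
Qed.
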